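(* Let $n\in\mathbb{N}$, $n\ge 2$. Then for every bounded continuous function $f$ on $[0,\infty)$, $$\big\|\widetilde{V}_n f-f\big\|\le 3\,K\Big(f,\frac{1}{n^2}\Big).$$
   Context: For $n\in\mathbb{N}$, $k=0,1,2,\ldots$ and $x\in[0,\infty)$ let $P_{n,k}(x)=\binom{n+k-1}{k}x^k(1+x)^{-n-k}$. Let $\psi(x)=x(1+x)$ and define the differential operator $\widetilde{D}f(x)=\psi(x)f''(x)$, with $\widetilde{D}^2f=\widetilde{D}\widetilde{D}f$. For Lebesgue measurable $f$ on $(0,\infty)$ with a finite limit $f(0)=\lim_{x\to0^+}f(x)$ put $v_{n,0}(f)=f(0)$ and $v_{n,k}(f)=(n+1)\int_0^\infty P_{n+2,k-1}(t)f(t)\,dt$ for $k\ge1$. Set $\widetilde{P}_{n,k}(x)=P_{n,k}(x)-\frac1n\widetilde{D}P_{n,k}(x)$ and $$\widetilde{V}_n(f,x)=\sum_{k=0}^\infty v_{n,k}(f)\widetilde{P}_{n,k}(x),\qquad x\in[0,\infty).$$ $\|\cdot\|$ is the uniform (essential supremum) norm on $[0,\infty)$. $AC_{loc}(0,\infty)$ is the set of functions absolutely continuous on every $[a,b]\subset(0,\infty)$. $W^2(\psi)=\{g: g,g'\in AC_{loc}(0,\infty),\ \widetilde{D}g\in L_\infty[0,\infty)\}$, and $W_0^2(\psi)$ is the subspace of those $g\in W^2(\psi)$ with $\lim_{x\to0^+}\widetilde{D}g(x)=0$. For $t>0$ the K-functional is $$K(f,t)=\inf\{\|f-g\|+t\|\widetilde{D}^2g\|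 : g\in W_0^2(\psi),\ \widetilde{D}g\in W^2(\psi)\}.$$ *)

(* Defs.v *)
From HB Require Import structures.
From mathcomp Require Import all_boot all_order all_algebra.
From mathcomp Require Import all_classical all_reals all_analysis.

Set Implicit Arguments.
Unset Strict Implicit.
Unset Printing Implicit Defensive.

Import Order.TTheory GRing.Theory Num.Theory.
Import numFieldNormedType.Exports.

Local Open Scope classical_set_scope.
Local Open Scope ring_scope.

(* Functions on (0,oo) or [0,oo) are represented by total functions R -> R;
   only their values on the half-line matter in what follows. *)

Definition baskakov {R : realType} (n k : nat) (x : R) : R :=
  'C((n + k - 1)%N, k)%:R * x ^+ k * (1 + x) ^- (n + k).

Definition psi {R : realType} (x : R) : R := x * (1 + x).

Definition Dtilde {R : realType} (f : R -> R) : R -> R :=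
  fun x => psi x * derive1n 2 f x.

(* For k = 0 this is the limit of f at 0+, which need not be the value that the
   total function f takes at 0. *)
Definition vcoef {R : realType} (n k : nat) (f : R -> R) : R :=
  if k is k'.+1 then
    n.+1%:R * \int[@lebesgue_measure R]_(t in `]0, +oo[) (baskakov n.+2 k' t * f t)
  else lim (f x @[x --> 0^'+]).

Definition Ptilde {R : realType} (n k : nat) : R -> R :=
  fun x => baskakov n k x - n%:R^-1 * Dtilde (baskakov n k) x.

Definition Vtilde {R : realType} (n : nat) (f : R -> R) (x : R) : R :=
  limn (series (fun k => vcoef n k f * Ptilde n k x)).

(* Extending by 0 off [0, oo) does not change the essential supremum of |h|
   over [0, oo). The value is +oo when h is not essentially bounded. *)
Definition supnorm {R : realType} (h : R -> R) : \bar R :=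
  Lnorm (@lebesgue_measure R) +oo%E (EFin \o (h \_ `[0, +oo[)).

Definition Linfty {R : realType} (h : R -> R) : Prop :=
  measurable_fun (`[0, +oo[ : set R) h /\ (supnorm h < +oo)%E.

Definition abs_continuous {R : realType} (a b : R) (h : R -> R) : Prop :=
  forall e : R, 0 < e -> exists2 d : R, 0 < d &
    forall (m : nat) (u v : 'I_m -> R),
      (forall i, a <= u i /\ u i <= v i /\ v i <= b) ->
      trivIset setT (fun i => `]u i, v i[%classic) ->
      \sum_(i < m) (v i - u i) < d ->
      \sum_(i < m) `|h (v i) - h (u i)| < e.

Definition AC_loc {R : realType} (h : R -> R) : Prop :=
  forall a b : R, 0 < a -> a <= b -> abs_continuous a b h.

(* When g' is AC_loc, g'' exists almost everywhere; where it does not exist,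
   the library's total derivative has a default value, on a null set. *)
Definition W2 {R : realType} (g : R -> R) : Prop :=
  [/\ AC_loc g,
      forall x : R, 0 < x -> derivable g x 1,
      AC_loc (derive1 g) &
      Linfty (Dtilde g)].

Definition W20 {R : realType} (g : R -> R) : Prop :=
  W2 g /\ Dtilde g x @[x --> 0^'+] --> (0 : R).

Definition Kfunctional {R : realType} (f : R -> R) (t : R) : \bar R :=
  ereal_inf [set (supnorm (f \- g)%R + t%:E * supnorm (Dtilde (Dtilde g)))%E
            | g in [set g : R -> R | W20 g /\ W2 (Dtilde g)]].

(* Main.v *)
Require Import Defs.
From HB Require Import structures.
From mathcomp Require Import all_boot all_order all_algebra.
From mathcomp Require Import all_classical all_reals all_analysis.
From mathcomp Require Import measurable_realfun ess_sup_inf.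
From mathcomp Require Import ring lra zify.
Set Implicit Arguments.
Unset Strict Implicit.
Unset Printing Implicit Defensive.
Import Order.TTheory GRing.Theory Num.Theory.
Import numFieldNormedType.Exports.
Local Open Scope classical_set_scope.
Local Open Scope ring_scope.

(** Write [V n f] for the sum of [vcoef n k f * baskakov n k], so that
[Vtilde n] is [V n] minus [Dtilde (V n)] divided by [n]. The bound follows from two
estimates through
[Vtilde n f - f = Vtilde n (f - g) + (Vtilde n g - g) - (f - g)]:
the operator [Vtilde n] has norm at most 2 ([norm_Vtilde_le]), and
[|Vtilde n g - g| <= ||Dtilde (Dtilde g)|| / n^2] for smooth [g]
([norm_Vtilde_sub]).

The norm. The numbers [baskakov n k x] form a negative binomial law in [k], and
[Ptilde n k x = (2 - q k) * baskakov n k x] for a quadratic polynomial [q] in [k]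
with mean 1 and second moment [3 + 2 / n]. As [|y| <= (y^2 + 4) / 4], the sum of
[|Ptilde n k x|] is at most [(4 - 4 + 3 + 2 / n + 4) / 4], which is at most 2
exactly when [n >= 2] ([series_norm_Ptilde_le2]).

The smooth estimate. On sequences of coefficients, applying [Dtilde] amounts to
taking weighted second differences, both in the basis ([cvg_series_Dtilde]) and
inside the integrals ([vcoef_second_difference]); hence
[Dtilde (V n g) = V n (Dtilde g)], where the condition that [Dtilde g] vanishes at 0
removes the coefficient of index 0. The same second differences express the
passage from [n] to [n + 1]:
[V (n + 1) g = V n g - V n (Dtilde g) / (n (n + 1))] ([bsum_up]). Since [V k g]
tends to [g] ([cvg_operator]), [V n g - g] is the sum over [k >= n] of
[V k (Dtilde g) / (k (k + 1))]; by the same identity for [Dtilde g], each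
[V k (Dtilde g)] is within [M (1 / n - 1 / k)] of [V n (Dtilde g)], where
[M = ||Dtilde (Dtilde g)||]. As the weights [1 / (k (k + 1))] add up to [1 / n],
the difference with [V n (Dtilde g) / n] is at most [M / n^2]
([telescoping_bound]).

Regularity. The essential bound on [Dtilde (Dtilde g)] concerns a second derivative
which exists only almost everywhere. It is used in one form only: the derivative of
[Dtilde g] has increments bounded by [M] times those of [dphi], a primitive of
[1 / psi] ([derive1_increment_dphi]). This requires that an absolutely continuous
function be the integral of its derivative, which is obtained by writing it as a
difference of two monotone ones by means of its total variation, taking
Radon-Nikodym densities of the corresponding Lebesgue-Stieltjes measures, and
differentiating the integrals of these densities ([abs_continuous_derive]). *)

(** * Absolutely continuous functions are integrals of their derivatives *)

Section AC.
Context {R : realType}.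
Implicit Types (a b : R) (h : R -> R).
Local Notation mu := (@lebesgue_measure R).

Lemma abs_continuous_fin a b h e : abs_continuous a b h -> 0 < e ->
  exists2 d : R, 0 < d & forall (I : finType) (u v : I -> R),
    (forall i, a <= u i /\ u i <= v i /\ v i <= b) ->
    trivIset setT (fun i => `]u i, v i[%classic) ->
    \sum_i (v i - u i) < d -> \sum_i `|h (v i) - h (u i)| < e.
Proof.
move=> hab e0; have [d d0 H] := hab e e0; exists d => // I u v uv tr.
have bij : {on [pred _ | true], bijective (@enum_val I predT)}.
  exact/onW_bij/enum_val_bij.
rewrite (reindex _ bij) [X in _ -> X < _](reindex _ bij) /= => ud.
apply: H => // i j _ _ ij; apply: enum_val_inj; exact: tr.
Qed.

Lemma itv_partition_nth_mono (u v : R) (s : seq R) k l :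
  itv_partition u v s -> (k <= l <= size s)%N ->
  nth v (u :: s) k <= nth v (u :: s) l.
Proof.
move=> [us _] /andP[kl ls].
have := @sorted_leq_nth _ <=%O le_trans le_refl v (u :: s).
apply => //; rewrite ?inE /= ?ltnS //; last exact: leq_trans kl ls.
by apply: sub_path us => x y /ltW.
Qed.

Lemma itv_partition_length (u v : R) (s : seq R) (t := nth v (u :: s)) :
  itv_partition u v s -> \sum_(k < size s) (t k.+1 - t k) = v - u.
Proof.
move=> uvs.
rewrite -(big_mkord xpredT (fun k => t k.+1 - t k)) (telescope_sumr t)//.
by rewrite /t (itv_partition_nth_size _ uvs).
Qed.

(** Subdividing disjoint intervals yields again disjoint intervals of the same total
length. The subintervals are indexed by a dependent pair, an interval and a
position in its subdivision. *)
Lemma abs_continuous_variation a b h e : abs_continuous a b h -> 0 < e ->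
  exists2 d : R, 0 < d & forall (m : nat) (u v : 'I_m -> R) (s : 'I_m -> seq R),
    (forall i, a <= u i /\ u i <= v i /\ v i <= b) ->
    trivIset setT (fun i => `]u i, v i[%classic) ->
    \sum_(i < m) (v i - u i) < d ->
    (forall i, itv_partition (u i) (v i) (s i)) ->
    \sum_(i < m) variation (u i) (v i) h (s i) < e.
Proof.
move=> hab e0; have [d d0 H] := abs_continuous_fin hab e0.
exists d => // m u v s uv tr uvd uvs.
pose J : finType := {i : 'I_m & 'I_(size (s i))}.
pose t i := nth (v i) (u i :: s i).
pose p (j : J) := t (tag j) (tagged j).
pose q (j : J) := t (tag j) (tagged j).+1.
have ut i k : (k <= size (s i))%N -> u i <= t i k.
  by move=> ks; exact: itv_partition_nth_ge.
have tv i k : (k <= size (s i))%N -> t i k <= v i.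
  by move=> ks; exact: itv_partition_nth_le.
have tm i k l : (k <= l <= size (s i))%N -> t i k <= t i l.
  by move=> kl; exact: itv_partition_nth_mono.
have pqle (j : J) : u (tag j) <= p j /\ q j <= v (tag j).
  by split; [apply: ut; exact: ltnW|exact: tv].
have -> : \sum_(i < m) variation (u i) (v i) h (s i) =
    \sum_(j : J) `|h (q j) - h (p j)|.
  rewrite -(sig_big_dep xpredT (fun _ => xpredT)
     (fun i (k : 'I_(size (s i))) => `|h (t i k.+1) - h (t i k)|)) /=.
  by apply: eq_bigr => i _; rewrite /variation big_mkord.
apply: H.
- move=> j; have [up qv] := pqle j; have [au [_ vb]] := uv (tag j).
  split; first exact: le_trans up.
  split; last exact: le_trans vb.
  by apply: tm; rewrite leqnSn /=.
- move=> [i k] [i' k'] _ _ [x [/=]]; rewrite !in_itv /= => xk xk'.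
  have ii' : i = i'.
    apply: tr => //; exists x; split; rewrite /= in_itv /=.
      have [/= up qv] := pqle (existT _ i k); move: xk; rewrite /p /q /=.
      by move=> /andP[px xq]; rewrite (le_lt_trans up px) (lt_le_trans xq qv).
    have [/= up qv] := pqle (existT _ i' k'); move: xk'; rewrite /p /q /=.
    by move=> /andP[px xq]; rewrite (le_lt_trans up px) (lt_le_trans xq qv).
  subst i'; congr existT; apply/val_inj/eqP; rewrite eqn_leq.
  move: xk xk'; rewrite /p /q /= => /andP[kx xk] /andP[k'x xk'].
  have half (k1 k2 : 'I_(size (s i))) : t i k1 < x -> x < t i k2.+1 -> (k1 <= k2)%N.
    move=> k1x xk2; rewrite leqNgt; apply/negP => k21.
    have := tm i k2.+1 k1; rewrite k21 ltnW // => /(_ isT) tt.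
    by have := lt_le_trans xk2 (le_trans tt (ltW k1x)); rewrite ltxx.
  by rewrite !half.
- rewrite -(sig_big_dep xpredT (fun _ => xpredT)
     (fun i (k : 'I_(size (s i))) => t i k.+1 - t i k)) /=.
  under eq_bigr do rewrite itv_partition_length //.
  by [].
Qed.

Lemma abs_continuousS a b c d h : a <= c -> d <= b ->
  abs_continuous a b h -> abs_continuous c d h.
Proof.
move=> ac db hab e e0; have [r r0 H] := hab e e0; exists r => // m u v uv.
apply: H => i; have [cu [-> vd]] := uv i.
by split; [exact: le_trans cu|split => //; exact: le_trans db].
Qed.

(** On an interval shorter than the modulus attached to [e = 1] every variation is
less than 1, and finitely many such intervals cover [[a, b]]. *)
Lemma abs_continuous_bounded_variation a b h : a <= b ->
  abs_continuous a b h -> bounded_variation a b h.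
Proof.
move=> ab hab.
have [d d0 H] := abs_continuous_variation hab ltr01.
have small c c' : a <= c -> c <= c' -> c' <= b -> c' - c < d ->
    (total_variation c c' h < +oo)%E.
  move=> ac cc' c'b c'd.
  have : bounded_variation c c' h.
    exists 1 => _ [s cs <-]; apply/ltW.
    have := H 1%N (fun=> c) (fun=> c') (fun=> s).
    rewrite !big_ord1; apply => //.
    by move=> i j _ _ _; rewrite !ord1.
  by move/(bounded_variationP _ cc'); rewrite fin_numElt => /andP[].
(* The number of pieces of length less than [d]. *)
pose N := (Num.truncn ((b - a) / d)).+1.
have N0 : (0 : R) < N%:R by rewrite ltr0n.
have bad : (b - a) / N%:R < d.
  rewrite ltr_pdivrMr // mulrC -ltr_pdivrMr //.
  by have := truncnS_gt ((b - a) / d).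
pose c k := a + k%:R * ((b - a) / N%:R).
have ba0 : 0 <= (b - a) / N%:R by rewrite divr_ge0 ?subr_ge0.
have cS k : c k.+1 = c k + (b - a) / N%:R by rewrite /c -natr1; ring.
have cN : c N = b by rewrite /c mulrC divfK ?gt_eqF //; ring.
have ac k : a <= c k by rewrite /c lerDl mulr_ge0.
have cb k : (k <= N)%N -> c k <= b.
  move=> kN; rewrite -cN /c lerD2l ler_wpM2r // ler_nat //.
apply/(bounded_variationP _ ab).
rewrite ge0_fin_numE ?total_variation_ge0 // -cN.
have : (N <= N)%N by []; elim: {1 3}N => [|k IH] kN.
  by rewrite /c mul0r addr0 total_variationxx.
rewrite (@total_variationD _ a (c k.+1) (c k)) //; last by rewrite cS lerDl.
by rewrite lte_add_pinfty ?IH ?small // ?(ltnW kN) // ?cb // cS ?lerDl // addrAC subrr add0r.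
Qed.

Lemma total_variation_sub a b h u v : abs_continuous a b h ->
  a <= u -> u <= v -> v <= b ->
  fine (total_variation a v h) - fine (total_variation a u h) =
  fine (total_variation u v h).
Proof.
move=> hab au uv vb.
have fn x y : a <= x -> x <= y -> y <= b -> total_variation x y h \is a fin_num.
  move=> ax xy yb; apply/bounded_variationP => //.
  by apply: abs_continuous_bounded_variation => //; exact: abs_continuousS hab.
have av : a <= v by exact: le_trans uv.
have ub : u <= b by exact: le_trans vb.
rewrite (@total_variationD _ a v u) // fineD ?fn //; first by rewrite addrAC subrr add0r.
Qed.

(** On each interval some subdivision comes within [eta] of the total variation;
[eta] is the remaining half of [e] shared between the intervals. *)
Lemma abs_continuous_total_variation a b h : abs_continuous a b h ->
  abs_continuous a b (fun x => fine (total_variation a x h)).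
Proof.
move=> hab e e0; have e20 : 0 < e / 2 by rewrite divr_gt0.
have [d d0 H] := abs_continuous_variation hab e20; exists d => // m u v uv tr uvd.
have [m0|m0] := posnP m; first by subst m; rewrite big_ord0.
pose eta := e / 2 / m%:R.
have eta0 : 0 < eta by rewrite divr_gt0 // ltr0n.
have ex i : {s | itv_partition (u i) (v i) s &
    fine (total_variation (u i) (v i) h) <= variation (u i) (v i) h s + eta}.
  apply: cid2; have [au [uvi vb]] := uv i.
  have bv : bounded_variation (u i) (v i) h.
    by apply: abs_continuous_bounded_variation => //; exact: abs_continuousS hab.
  move: uvi; rewrite le_eqVlt => /predU1P[->|uvi].
    exists [::]; first by split => //=.
    by rewrite total_variationxx /variation /= big_nil add0r ltW.
  have := @sup_adherent _ (variations (u i) (v i) h) _ eta0 _.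
  case; first by split => //; exact: variations_neq0.
  move=> _ [s us <-] /ltW sv; exists s => //.
  rewrite /total_variation ereal_sup_EFin //=; last exact: variations_neq0.
  by rewrite -lerBlDr.
have -> : \sum_(i < m) `|fine (total_variation a (v i) h) -
    fine (total_variation a (u i) h)| =
    \sum_(i < m) fine (total_variation (u i) (v i) h).
  apply: eq_bigr => i _; have [au [uvi vb]] := uv i.
  by rewrite (total_variation_sub hab) // ger0_norm // fine_ge0 // total_variation_ge0.
apply: (@le_lt_trans _ _ (\sum_(i < m) (variation (u i) (v i) h (s2val (ex i)) + eta))).
  by apply: ler_sum => i _; case: (ex i).
rewrite big_split /= sumr_const card_ord -(mulr_natl eta) [m%:R * _]mulrC divfK; last first.
  by rewrite pnatr_eq0 -lt0n.
by rewrite [ltRHS]splitr ltrD2r; apply: H => // i; case: (ex i).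
Qed.
End AC.

Section LS.
Context {R : realType}.
Implicit Types (a b : R) (h : R -> R).
Local Notation mu := (@lebesgue_measure R).

Lemma lebesgue_stieltjes_itvoc (C : cumulative R R) (p q : R) : p <= q ->
  lebesgue_stieltjes_measure C `]p, q] = (C q - C p)%:E.
Proof.
move=> pq; rewrite /lebesgue_stieltjes_measure /measure_extension.
by rewrite measurable_mu_extE /= ?wlength_itv_bnd //; exact: is_ocitv.
Qed.

Lemma open_interval_finite_measure (I : set R) : open I -> is_interval I ->
  (mu I < +oo)%E -> exists p q, p <= q /\ I = `]p, q[%classic.
Proof.
move=> oI iI muI.
have mI : measurable I by exact: open_measurable.
have [->|/set0P[x Ix]] := eqVneq I set0.
  by exists 0, 0; split => //; rewrite set_itv_ge // bnd_simp ltxx.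
have far y z : I y -> I z -> y <= z -> ((z - y)%:E <= mu I)%E.
  move=> Iy Iz yz; have -> : (z - y)%:E = mu `[y, z]%classic.
    by rewrite lebesgue_measure_itv /= lte_fin; rewrite lt_neqAle yz andbT; case: eqVneq => [->|_] /=; rewrite ?subrr // EFinB.
  by apply: le_measure; rewrite ?inE // => t /=; rewrite in_itv /= => /iI; exact.
have fin : (mu I)%E = (fine (mu I))%:E by rewrite fineK // ge0_fin_numE.
have lb : has_lbound I.
  exists (x - fine (mu I)) => y Iy; have [yx|/ltW xy] := leP y x.
    by have := far y x Iy Ix yx; rewrite fin lee_fin => ?; lra.
  by apply: le_trans xy; rewrite lerBlDr lerDl fine_ge0.
have ub : has_ubound I.
  exists (x + fine (mu I)) => y Iy; have [xy|/ltW yx] := leP x y.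
    by have := far x y Ix Iy xy; rewrite fin lee_fin => ?; lra.
  by apply: (le_trans yx); rewrite lerDl fine_ge0.
exists (inf I), (sup I); split.
  by apply: (@le_trans _ _ x); [exact: ge_inf|exact: ub_le_sup].
have := interval_bounded_interior iI lb ub.
by rewrite (interior_id _).1 // => {1}->.
Qed.

(** A null set lies in an open set of small Lebesgue measure, whose components are
disjoint intervals; the increments of [C] over any finite number of them are small. *)
Lemma lebesgue_stieltjes_dominated (C : cumulative R R) :
  (forall e, 0 < e -> exists2 d : R, 0 < d & forall (m : nat) (u v : 'I_m -> R),
      (forall i, u i <= v i) ->
      trivIset setT (fun i => `]u i, v i[%classic) ->
      \sum_(i < m) (v i - u i) < d -> \sum_(i < m) (C (v i) - C (u i)) < e) ->
  forall A : set R, measurable A -> mu A = 0 -> lebesgue_stieltjes_measure C A = 0.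
Proof.
move=> Cac A mA muA0; apply/eqP; rewrite eq_le measure_ge0 andbT.
apply/lee_addgt0Pr => e e0; rewrite add0e.
have [d d0 H] := Cac e e0.
have [|U [oU AU UAd]] := @lebesgue_regularity_outer R A d mA _ d0.
  by rewrite [X in (X < _)%E]muA0 ltry.
have mU : measurable U by exact: open_measurable.
have muU : (mu U < d%:E)%E.
  apply: le_lt_trans UAd; rewrite -[leRHS]add0e -muA0.
  rewrite -{1}(setDUK AU); apply: measureU2 => //; exact: measurableD.
pose I := open_disjoint_itv oU.
have mI k : measurable (I k) by apply: open_measurable; exact: open_disjoint_itv_open.
have UI : U = \bigcup_k I k by exact: open_disjoint_itv_bigcup.
have pq k : exists pq : R * R, pq.1 <= pq.2 /\ I k = `]pq.1, pq.2[%classic.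
  have [|||p [q [? ?]]] := @open_interval_finite_measure (I k).
  - exact: open_disjoint_itv_open.
  - exact: open_disjoint_itv_is_interval.
  - apply: (@le_lt_trans _ _ (mu U)); last by rewrite (lt_trans muU) ?ltry.
    apply: le_measure; rewrite ?inE; [exact: mI|exact: mU|].
    by move=> x Ix; rewrite UI; exists k.
  - by exists (p, q).
have {pq}[pq pqP] := choice pq.
apply: (@le_trans _ _ (lebesgue_stieltjes_measure C U)).
  by apply: le_measure; rewrite ?inE.
have := @measure_semi_sigma_additive _ _ _ (lebesgue_stieltjes_measure C) I mI
  (open_disjoint_itv_trivIset (oU:=oU)).
rewrite -UI => /(_ mU) cv; rewrite -(cvg_lim _ cv) //.
apply: lime_le; first by apply/cvg_ex; eexists; exact: cv.
apply: nearW => n; rewrite big_mkord.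
apply: (@le_trans _ _ (\sum_(i < n) (C (pq i).2 - C (pq i).1)%:E)%E).
  apply: lee_sum => i _; have [pqi ->] := pqP i.
  rewrite -lebesgue_stieltjes_itvoc //.
  by apply: le_measure; rewrite ?inE //; exact: subset_itv_oo_oc.
rewrite sumEFin lee_fin ltW //; apply: H.
- by move=> i; case: (pqP i).
- move=> i j _ _; rewrite -(pqP i).2 -(pqP j).2 => ij; apply/val_inj.
  exact: (open_disjoint_itv_trivIset (oU:=oU)).
rewrite -lte_fin; apply: le_lt_trans muU.
have -> : (\sum_(i < n) ((pq i).2 - (pq i).1))%:E = (\sum_(i < n) mu (I i))%E.
  rewrite -sumEFin; apply: eq_bigr => i _; have [pqi ->] := pqP i.
  rewrite lebesgue_measure_itv /= lte_fin.
  by rewrite lt_neqAle pqi andbT; case: eqVneq => [->|_] /=; rewrite ?subrr // EFinB.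
rewrite -(measure_bigsetU mu) //.
  apply: le_measure; rewrite ?inE; [by apply: bigsetU_measurable => k _; exact: mI|exact: mU|].
  by rewrite [X in _ `<=` X]UI; exact: bigsetU_bigcup.
exact: (open_disjoint_itv_trivIset (oU:=oU)).
Qed.

End LS.

Section FTC.
Context {R : realType}.
Implicit Types (a b : R) (h : R -> R).
Local Notation mu := (@lebesgue_measure R).

(** The density is the Radon-Nikodym derivative of the Lebesgue-Stieltjes measure of
[F]. That measure is built from a monotone function on the whole line, hence the
extension of [F] by constants outside [[a, b]]. *)
Lemma nondecreasing_abs_continuous_density a b (F : R -> R) : a < b ->
  {in `[a, b] &, {homo F : x y / x <= y}} -> abs_continuous a b F ->
  exists f : R -> R, mu.-integrable setT (EFin \o f) /\
    forall x, a <= x <= b -> F x - F a = \int[mu]_(t in `]a, x]) f t.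
Proof.
move=> ab ndF acF.
pose cl x := Num.max a (Num.min x b).
have clP x : a <= cl x <= b.
  by rewrite /cl le_max lexx ge_max (ltW ab) ge_min lexx orbT.
have clid x : a <= x <= b -> cl x = x.
  by move=> /andP[ax xb]; rewrite /cl min_l // max_r.
have cl_le x y : x <= y -> cl x <= cl y /\ cl y - cl x <= y - x.
  move=> xy; rewrite /cl.
  have [? ?] : Num.min x b <= Num.min y b /\ Num.min y b - Num.min x b <= y - x.
    by rewrite !minElt; case: (ltP x b) => ?; case: (ltP y b) => ?; split; lra.
  by rewrite !maxElt; case: (ltP a (Num.min x b)) => ?; case: (ltP a (Num.min y b)) => ?;
    split; lra.
pose Fe x := F (cl x).
have ndFe : nondecreasing Fe.
  by move=> x y xy; apply: ndF; rewrite ?in_itv /= ?clP // (cl_le _ _ xy).1.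
have acFe e : 0 < e -> exists2 d : R, 0 < d & forall (m : nat) (u v : 'I_m -> R),
      (forall i, u i <= v i) ->
      trivIset setT (fun i => `]u i, v i[%classic) ->
      \sum_(i < m) (v i - u i) < d -> \sum_(i < m) (Fe (v i) - Fe (u i)) < e.
  move=> e0; have [d d0 H] := acF e e0; exists d => // m u v uv tr uvd.
  apply: (@le_lt_trans _ _ (\sum_(i < m) `|F (cl (v i)) - F (cl (u i))|)).
    by apply: ler_sum => i _; exact: ler_norm.
  apply: H.
  - move=> i; have [cuv _] := cl_le _ _ (uv i).
    by have /andP[? _] := clP (u i); have /andP[_ ?] := clP (v i).
  - move=> i j _ _ [x [/=]]; rewrite !in_itv /= => /andP[ix xi] /andP[jx xj].
    have cl_oo k : cl (u k) < x -> x < cl (v k) -> u k < x < v k.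
      rewrite /cl gt_max lt_max gt_min lt_min => /andP[ax /orP[->|bx]] /=.
        by case/orP => [|/andP[]//]; rewrite ltNge (ltW ax).
      by case/orP => [|/andP[_]]; rewrite ltNge ?(ltW ax) ?(ltW bx).
    by apply: tr => //; exists x; split; rewrite /= in_itv /= cl_oo.
  - by apply: le_lt_trans uvd; apply: ler_sum => i _; exact: (cl_le _ _ (uv i)).2.
have contFe x : Fe y @[y --> x] --> Fe x.
  apply/cvgrPdist_lt => e e0; have [d d0 H] := acFe e e0.
  have H1 u v : u <= v -> v - u < d -> Fe v - Fe u < e.
    move=> uv uvd; have := H 1%N (fun=> u) (fun=> v); rewrite !big_ord1; apply => //.
    by move=> i j _ _ _; rewrite !ord1.
  near=> y; have : `|x - y| < d by near: y; exact: cvgr_dist_lt.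
  have [xy|/ltW yx] := leP x y.
    by rewrite ler0_norm ?subr_le0 // ler0_norm ?subr_le0 ?ndFe // !opprB; exact: H1.
  by rewrite ger0_norm ?subr_ge0 // ger0_norm ?subr_ge0 ?ndFe //; exact: H1.
have rcFe : right_continuous Fe by move=> x; apply: cvg_within_filter; exact: contFe.
pose C : cumulative R R := HB.pack_for (cumulative R R) Fe
  (isCumulative.Build R _ R Fe ndFe rcFe).
have mD : measurable (`]a, b]%classic : set (measurableTypeR R)) by exact: measurable_itv.
have nuD : (lebesgue_stieltjes_measure C `]a, b]%classic < +oo)%E.
  by rewrite lebesgue_stieltjes_itvoc ?ltry // ltW.
pose nu : {finite_measure set (measurableTypeR R) -> \bar R} := mfrestr mD nuD.
have dom : nu `<< mu.
  apply/null_content_dominatesP => A mA muA0.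
  apply/eqP; rewrite eq_le measure_ge0 andbT /nu /= /mfrestr /= /mrestr.
  rewrite -[leRHS](lebesgue_stieltjes_dominated (C:=C) acFe mA muA0).
  by apply: le_measure; rewrite ?inE //; by [exact: measurableI|exact: subIsetl].
have [f [f0 ff fi fE]] := radon_nikodym_sigma_finite dom.
exists (fine \o f).
have -> : EFin \o (fine \o f) = f by apply/funext => x /=; rewrite fineK.
split=> // x /andP[ax xb].
rewrite /Rintegral; under eq_integral do rewrite /= fineK //.
rewrite -fE; last exact: measurable_itv.
rewrite /nu /= /mfrestr /= /mrestr.
rewrite setIidl; last by move=> y /=; rewrite !in_itv /= => /andP[-> /le_trans ->].
rewrite lebesgue_stieltjes_itvoc //= /Fe !clid // ?ax ?xb //.
by rewrite lexx ltW.
Unshelve. all: by end_near. Qed.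

End FTC.

Section FTC.
Context {R : realType}.
Implicit Types (a b : R) (h : R -> R).
Local Notation mu := (@lebesgue_measure R).

(** [h] is the difference of its total variation [T] and of [T - h], both
nondecreasing and absolutely continuous. *)
Lemma abs_continuous_density a b h : a < b -> abs_continuous a b h ->
  exists f : R -> R, mu.-integrable setT (EFin \o f) /\
    forall x, a <= x <= b -> h x - h a = \int[mu]_(t in `]a, x]) f t.
Proof.
move=> ab hac; pose T x := fine (total_variation a x h).
have Tac : abs_continuous a b T by exact: abs_continuous_total_variation.
have Tsub u v : a <= u -> u <= v -> v <= b -> `|h v - h u| <= T v - T u.
  move=> au uv vb; rewrite /T (total_variation_sub hac) // -lee_fin fineK.
    exact: total_variation_ge.
  apply/bounded_variationP => //; apply: abs_continuous_bounded_variation => //.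
  exact: abs_continuousS hac.
have [f [fi fE]] : exists f : R -> R, mu.-integrable setT (EFin \o f) /\
    forall x, a <= x <= b -> T x - T a = \int[mu]_(t in `]a, x]) f t.
  apply: (nondecreasing_abs_continuous_density ab) => // x y.
  rewrite !in_itv /= => /andP[ax xb] /andP[ay yb] xy.
  by rewrite -subr_ge0; apply: le_trans (Tsub _ _ ax xy yb).
pose S x := T x - h x.
have [g [gi gE]] : exists g : R -> R, mu.-integrable setT (EFin \o g) /\
    forall x, a <= x <= b -> S x - S a = \int[mu]_(t in `]a, x]) g t.
  apply: (nondecreasing_abs_continuous_density ab).
    move=> x y; rewrite !in_itv /= => /andP[ax xb] /andP[ay yb] xy.
    by have := Tsub x y ax xy yb; rewrite ler_norml /S => /andP[]; lra.
  move=> e e0; have e20 : 0 < e / 2 by rewrite divr_gt0.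
  have [d1 d10 H1] := Tac _ e20; have [d2 d20 H2] := hac _ e20.
  exists (Num.min d1 d2); first by rewrite lt_min d10.
  move=> m u v uv tr; rewrite lt_min => /andP[ud1 ud2].
  rewrite [ltRHS]splitr; apply: le_lt_trans (ltrD (H1 m u v uv tr ud1) (H2 m u v uv tr ud2)).
  rewrite -big_split /=; apply: ler_sum => i _; rewrite /S.
  have -> : T (v i) - h (v i) - (T (u i) - h (u i)) =
    (T (v i) - T (u i)) - (h (v i) - h (u i)) by ring.
  exact: ler_normB.
exists (f \- g); split; first exact: (integrableB measurableT fi gi).
move=> x axb; rewrite RintegralB //.
- by rewrite -fE // -gE // /S; ring.
- exact: integrableS fi.
- exact: integrableS gi.
Qed.

Lemma abs_continuous_derive a b h : a < b -> abs_continuous a b h ->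
  exists f : R -> R, [/\ mu.-integrable setT (EFin \o f),
    forall x, a <= x <= b -> h x - h a = \int[mu]_(t in `]a, x]) f t &
    {ae mu, forall x, a < x < b -> derivable h x 1 /\ derive1 h x = f x}].
Proof.
move=> ab hac; have [f [fi fE]] := abs_continuous_density ab hac.
exists f; split => //.
have fiy (y : R) : mu.-integrable [set` Interval (BRight a) (BRight y)] (EFin \o f).
  exact: integrableS fi.
have fl : locally_integrable [set: R] f.
  have := @integrable_locally R f setT measurableT fi.
  by rewrite patch_setT.
have := FTC1 fiy fl; apply: filterS; first exact: (ae_filter_ringOfSetsType mu).
move=> x H /andP[ax xb].
have [//|Fd FE] := H _.
set F := (fun x : R => _) in Fd FE.
have nearE : \forall y \near x, F y = h y - h a.
  have : x \in `]a, b[ by rewrite in_itv /= ax.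
  move/near_in_itvoo; apply: filterS => y; rewrite in_itv /= => /andP[ay yb].
  by rewrite fE // (ltW ay) (ltW yb).
have : is_derive x 1 (fun y => h y - h a) (f x).
  apply: near_eq_is_derive nearE _; rewrite -FE derive1E; exact: derivableP.
move=> /(is_deriveD (is_derive_cst (h a) x 1)).
rewrite add0r (_ : _ + _ = h); last first.
  by apply/funext => y; rewrite fctE /= addrC subrK.
by move=> hf; split; [exact: ex_derive|rewrite derive1E; exact: derive_val].
Qed.

(** For absolutely continuous functions a bound on the derivative almost everywhere
suffices, because they are the integrals of their derivatives. *)
Lemma abs_continuous_increment_le a b h (K k : R -> R) : a <= b ->
  abs_continuous a b h ->
  {within `[a, b], continuous k} ->
  (forall x, a <= x <= b -> is_derive x 1 K (k x)) ->
  {ae mu, forall x, a < x < b -> derive1 h x <= k x} ->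
  h b - h a <= K b - K a.
Proof.
rewrite le_eqVlt => /predU1P[<-|ab hac kc Kk hk]; first by rewrite !subrr.
have [f [fi fE hf]] := abs_continuous_derive ab hac.
rewrite fE; last by rewrite lexx ltW.
have Kc x : a <= x <= b -> {for x, continuous K}.
  by move=> axb; apply: differentiable_continuous; apply/derivable1_diffP;
     apply: ex_derive; exact: Kk.
have ki : mu.-integrable `[a, b] (EFin \o k).
  apply: continuous_compact_integrable => //; exact: segment_compact.
have FTC : (\int[mu]_(x in `[a, b]) (k x)%:E = (K b)%:E - (K a)%:E)%E.
  apply: continuous_FTC2 => //.
    split.
    - move=> x; rewrite in_itv /= => /andP[ax xb]; apply: ex_derive.
      by apply: Kk; rewrite !ltW.
    - by apply: cvg_within_filter; apply: Kc; rewrite lexx ltW.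
    - by apply: cvg_within_filter; apply: Kc; rewrite lexx ltW.
  move=> x; rewrite in_itv /= => /andP[ax xb]; rewrite derive1E.
  by apply: derive_val; apply: Kk; rewrite !ltW.
have kab : mu.-integrable `]a, b] (EFin \o k).
  by apply: integrableS ki => //; exact: subset_itv_oc_cc.
have -> : K b - K a = \int[mu]_(t in `]a, b]) k t.
  rewrite /Rintegral integral_itv_obnd_cbnd ?FTC //.
  by case/integrableP: kab.
have fab : mu.-integrable `]a, b] (EFin \o f) by exact: integrableS fi.
rewrite -subr_ge0 -RintegralB //.
have kfab : mu.-integrable `]a, b] (EFin \o (k \- f)).
  exact: (integrableB _ kab fab).
have -> : \int[mu]_(x in `]a, b]) (k x - f x) = \int[mu]_(x in `]a, b]) `|k x - f x|.
  congr fine; apply: ae_eq_integral => //.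
  - by case/integrableP: kfab.
  - by case/integrableP: (integrable_norm kfab).
  - have nb : {ae mu, forall x, x != b}.
      exists [set b]; split => //; first exact: lebesgue_measure_set1.
      by move=> x /= /negP; rewrite negbK => /eqP.
    move: hf hk nb; apply: filterS3; first exact: (ae_filter_ringOfSetsType mu).
    move=> x hf hk xb; rewrite /= in_itv /= => /andP[ax xleb].
    have axb : a < x < b by rewrite ax lt_neqAle xb.
    by have [_ <-] := hf axb; rewrite ger0_norm // subr_ge0; exact: hk.
by apply: Rintegral_ge0 => x _.
Qed.

Lemma abs_continuousN a b h : abs_continuous a b h -> abs_continuous a b (\- h).
Proof.
move=> hac e e0; have [d d0 H] := hac e e0; exists d => // m u v uv tr uvd.
under eq_bigr do rewrite /= -opprD normrN.
exact: H.
Qed.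

Lemma abs_continuous_increment_ge a b h (K k : R -> R) : a <= b ->
  abs_continuous a b h ->
  {within `[a, b], continuous k} ->
  (forall x, a <= x <= b -> is_derive x 1 K (k x)) ->
  {ae mu, forall x, a < x < b -> k x <= derive1 h x} ->
  K b - K a <= h b - h a.
Proof.
rewrite le_eqVlt => /predU1P[<-|ab hac kc Kk hk]; first by rewrite !subrr.
rewrite -lerN2 [leLHS](_ : _ = (\- h) b - (\- h) a) /=; last by rewrite opprB addrC opprK.
rewrite [leRHS](_ : _ = (\- K) b - (\- K) a) /=; last by rewrite opprB addrC opprK.
apply: (@abs_continuous_increment_le a b (\- h) (\- K) (\- k) (ltW ab)).
- exact: abs_continuousN.
- by move=> x; apply: continuousN; exact: kc.
- by move=> x xab; have ? := Kk x xab; exact: is_deriveN.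
- have [f [_ _ hf]] := abs_continuous_derive ab hac.
  move: hf hk; apply: filterS2; first exact: (ae_filter_ringOfSetsType mu).
  move=> x hf hk axb; have [dh _] := hf axb.
  by rewrite derive1E deriveN // lerN2 -derive1E hk.
Qed.

End FTC.

(** * Functions of the class [W2] *)

Section W2.
Context {R : realType}.
Implicit Types (a b x : R) (g h : R -> R).
Local Notation mu := (@lebesgue_measure R).

Lemma psi_gt0 x : 0 < x -> 0 < psi x.
Proof. by move=> x0; rewrite /psi mulr_gt0 // addr_gt0. Qed.

Lemma supnorm_leP h (M : R) : (supnorm h <= M%:E)%E <->
  {ae mu, forall x, 0 <= x -> `|h x| <= M}.
Proof.
have muT : (0 < mu [set: R])%E.
  by rewrite -set_itvNyy lebesgue_measure_itv /= ltry.
have supE : supnorm h = ess_sup mu (abse \o (EFin \o (h \_ `[0, +oo[))).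
  by rewrite /supnorm unlock muT.
rewrite supE; split => [/ess_supP|hM].
  apply: filterS.
  move=> x /= + x0; rewrite patchE mem_set /= ?in_itv /= ?x0 //.
have M0 : 0 <= M.
  have [//|M0] := leP 0 M.
  have : {ae mu, forall x : R, ~ 0 <= x}.
    move: hM; apply: filterS; first exact: (ae_filter_ringOfSetsType mu).
    by move=> x hx /hx; apply/negP; rewrite -ltNge (lt_le_trans M0).
  case=> N [mN N0 sN]; have : (mu `[0%R, +oo[ <= mu N)%E.
    apply: le_measure; rewrite ?inE //.
    by move=> x /=; rewrite in_itv /= andbT => x0; apply: sN => /=; apply.
  by rewrite N0 lebesgue_measure_itv /= ltry /= leye_eq.
apply/ess_supP; move: hM; apply: filterS; first exact: (ae_filter_ringOfSetsType mu).
move=> x hx /=; rewrite patchE; case: ifPn => [|_]; last by rewrite normr0 lee_fin.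
by rewrite inE /= in_itv /= andbT lee_fin => /hx.
Qed.

Lemma supnorm_ge0 h : (0 <= supnorm h)%E.
Proof. exact: Lnorm_ge0. Qed.

Lemma AC_loc_continuous h x : AC_loc h -> 0 < x -> {for x, continuous h}.
Proof.
move=> hac x0; apply/cvgrPdist_lt => e e0.
have x20 : 0 < x / 2 by rewrite divr_gt0.
have [|d d0 H] := hac (x / 2) (x + x / 2) x20 _ _ e0; first by lra.
have H1 u v : x / 2 <= u -> u <= v -> v <= x + x / 2 -> v - u < d -> `|h v - h u| < e.
  move=> xu uv vx uvd; have := H 1%N (fun=> u) (fun=> v); rewrite !big_ord1; apply => //.
  by move=> i j _ _ _; rewrite !ord1.
near=> y.
have yd : `|x - y| < d by near: y; exact: cvgr_dist_lt.
have yx : `|x - y| < x / 2 by near: y; exact: cvgr_dist_lt.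
have [yd1 yd2] := ltr_normlP _ _ yd; have [yx1 yx2] := ltr_normlP _ _ yx.
have [xy|/ltW xy] := leP x y.
  by rewrite distrC; have := H1 x y; apply; lra.
by have := H1 y x; apply; lra.
Unshelve. all: by end_near. Qed.

Lemma is_derive_of_bound (f : R -> R) (x l : R) :
  (forall e : R, 0 < e -> exists2 d : R, 0 < d & forall y : R, `|y - x| < d ->
     `|f y - f x - l * (y - x)| <= e * `|y - x|) ->
  is_derive x 1 f l.
Proof.
move=> H.
suff cv : h^-1 *: ((f \o shift x) (h *: 1) - f x) @[h --> 0^'] --> l.
  by apply: DeriveDef; [apply/cvg_ex; exists l|exact/cvg_lim].
apply/cvgrPdist_le => e e0; have [d d0 Hd] := H e e0.
near=> t.
have t0 : t != 0 by near: t; exact: nbhs_dnbhs_neq.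
have td : `|t| < d by near: t; exact: dnbhs0_lt.
rewrite /= [t *: 1]mulr1.
have := Hd (t + x); rewrite addrK => /(_ td) Ht.
rewrite distrC -(ler_pM2r (x := `|t|)) ?normr_gt0 // -normrM.
by apply: le_trans Ht; rewrite le_eqVlt; apply/orP; left; apply/eqP; congr (`|_|);
  rewrite /GRing.scale /=; field.
Unshelve. all: by end_near. Qed.

(** A primitive of [1 / psi]. *)
Definition dphi x : R := ln x - ln (1 + x).

Lemma is_derive_dphi x : 0 < x -> is_derive x 1 dphi (psi x)^-1.
Proof.
move=> x0; have x10 : 0 < 1 + x by rewrite addr_gt0.
have d1 := is_derive1_ln x0.
have d2 : is_derive x 1 (fun y => ln (1 + y) : R) (1 + x)^-1.
  have da : is_derive x 1 (fun y : R => 1 + y) 1.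
    by have := is_deriveD (is_derive_cst (1 : R) x 1) (is_derive_id x 1); rewrite add0r.
  by have := is_derive1_comp (is_derive1_ln x10) da; rewrite mulr1.
have -> : (psi x)^-1 = x^-1 - (1 + x)^-1.
  by rewrite /psi; field; rewrite !gt_eqF.
exact: (is_deriveB d1 d2).
Qed.

(** [dphi] is a primitive of [1 / psi], and [M / psi] bounds the second derivative of
[g] almost everywhere. *)
Lemma derive1_increment_dphi g (M : R) a b : AC_loc (derive1 g) ->
  (supnorm (Dtilde g) <= M%:E)%E -> 0 < a -> a <= b ->
  `|derive1 g b - derive1 g a| <= M * (dphi b - dphi a).
Proof.
move=> gac /supnorm_leP gM a0 ab.
have pos x : a <= x <= b -> 0 < x by move=> /andP[ax _]; exact: lt_le_trans ax.
have cst_psi (c : R) : {within `[a, b], continuous (fun x => c * (psi x)^-1)}.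
  apply: continuous_in_subspaceT => x; rewrite inE /= in_itv /= => /pos x0.
  apply: cvgM; first exact: cvg_cst.
  apply: cvgV; first by rewrite gt_eqF // psi_gt0.
  by rewrite /psi; apply: cvgM => //; apply: cvgD => //; exact: cvg_cst.
have dK (c : R) x : a <= x <= b -> is_derive x 1 (fun x => c * dphi x) (c * (psi x)^-1).
  by move=> /pos x0; have := is_derive_dphi x0 => ?; apply: is_deriveZ.
have ae : {ae mu, forall x, a < x < b -> `|derive1 (derive1 g) x| <= M * (psi x)^-1}.
  move: gM; apply: filterS; first exact: (ae_filter_ringOfSetsType mu).
  move=> x gx /andP[ax xb]; have x0 : 0 < x by exact: lt_trans ax.
  rewrite ler_pdivlMr ?psi_gt0 //; have := gx (ltW x0).
  by rewrite /Dtilde normrM (gtr0_norm (psi_gt0 x0)) mulrC.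
have gab := gac a b a0 ab.
rewrite ler_norml; apply/andP; split.
  have := @abs_continuous_increment_ge R a b (derive1 g) _ _ ab gab (cst_psi (- M)) (dK (- M)).
  have -> : - (M * (dphi b - dphi a)) = - M * dphi b - - M * dphi a by ring.
  apply; move: ae; apply: filterS; first exact: (ae_filter_ringOfSetsType mu).
  by move=> x gx /gx; rewrite ler_norml mulNr => /andP[].
have := @abs_continuous_increment_le R a b (derive1 g) _ _ ab gab (cst_psi M) (dK M).
have -> : M * (dphi b - dphi a) = M * dphi b - M * dphi a by ring.
apply; move: ae; apply: filterS; first exact: (ae_filter_ringOfSetsType mu).
by move=> x gx /gx; exact: le_trans (ler_norm _).
Qed.

(** A null set contains no nondegenerate interval. *)
Lemma ae_exists_itv (P : R -> Prop) x y : {ae mu, forall z, P z} -> x < y ->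
  exists2 z, x < z < y & P z.
Proof.
move=> [N [mN N0 sN]] xy; apply: contrapT => noz.
have : (mu `]x, y[ <= mu N)%E.
  apply: le_measure; rewrite ?inE // => z /=; rewrite in_itv /= => zxy.
  by apply: sN => Pz; apply: noz; exists z.
by rewrite N0 lebesgue_measure_itv /= lte_fin xy leNgt lte_fin subr_gt0 xy.
Qed.

Lemma supnorm_bound h (M : R) : (forall x, 0 < x -> {for x, continuous h}) ->
  (supnorm h <= M%:E)%E -> forall x, 0 < x -> `|h x| <= M.
Proof.
move=> hc /supnorm_leP hM x x0; apply/ler_addgt0Pr => e e0.
have /cvgrPdist_lt/(_ e e0) := hc x x0.
rewrite near_simpl => /nbhs_ballP[d /= d0 Hd].
have [|z /andP[xz zd] hz] := @ae_exists_itv _ x (x + d) hM; first by rewrite ltrDl.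
have z0 : 0 < z by exact: lt_trans xz.
have := hz (ltW z0); have : `|h x - h z| < e.
  by apply: Hd; rewrite /ball /= ltr0_norm ?subr_lt0 // opprB ltrBlDl.
rewrite -{2}(subrK (h z) (h x)) => hxz hzM.
by apply: le_trans (ler_normD _ _) _; rewrite addrC lerD // ltW.
Qed.

(** Membership in [W2] provides the second derivative of [g] almost everywhere only.
Since it agrees there with the continuous function [Dtilde g / psi], the difference
quotients of [derive1 g] near [x] are pinched around the value at [x]. *)
Lemma is_derive_derive1 g x : AC_loc (derive1 g) -> AC_loc (Dtilde g) -> 0 < x ->
  is_derive x 1 (derive1 g) (Dtilde g x / psi x).
Proof.
move=> gac Gac x0; pose c := Dtilde g x / psi x.
have gE y : 0 < y -> derive1 (derive1 g) y = Dtilde g y / psi y.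
  by move=> y0; rewrite /Dtilde mulrAC divff ?mul1r // gt_eqF // psi_gt0.
have cc : {for x, continuous (fun y => Dtilde g y / psi y)}.
  apply: cvgM; first exact: AC_loc_continuous.
  apply: cvgV; first by rewrite gt_eqF // psi_gt0.
  by rewrite /psi; apply: cvgM => //; apply: cvgD => //; exact: cvg_cst.
apply: is_derive_of_bound => e e0.
have /cvgrPdist_le/(_ e e0) := cc.
rewrite near_simpl => /nbhs_ballP[d /= d0 Hd].
exists (Num.min d x); first by rewrite lt_min d0.
have small u v : 0 < u -> u <= v -> (forall y, u < y < v -> `|c - Dtilde g y / psi y| <= e) ->
    `|derive1 g v - derive1 g u - c * (v - u)| <= e * (v - u).
  move=> u0 uv Huv; have guv := gac u v u0 uv.
  have dk (k : R) y : u <= y <= v -> is_derive y 1 (fun z => k * z) k.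
    by move=> _; apply: (is_derive_eq (is_deriveZ k (is_derive_id y 1))); rewrite /GRing.scale /= mulr1.
  have ck (k : R) : {within `[u, v], continuous (fun _ : R => k)} by move=> ?; exact: cvg_cst.
  have cle y : u < y < v -> c - e <= derive1 (derive1 g) y <= c + e.
    move=> uyv; have /andP[uy _] := uyv; have := Huv y uyv.
    by rewrite gE ?(lt_trans u0) // ler_norml => /andP[? ?]; apply/andP; split; lra.
  have := abs_continuous_increment_le uv guv (ck (c + e)) (dk (c + e)).
  have := abs_continuous_increment_ge uv guv (ck (c - e)) (dk (c - e)).
  have aeT (Q : R -> Prop) : (forall z, Q z) -> {ae mu, forall z, Q z}.
    by move=> hQ; apply: nearW.
  move=> /(_ (aeT _ (fun z huv => proj1 (andP (cle z huv))))) L1.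
  move=> /(_ (aeT _ (fun z huv => proj2 (andP (cle z huv))))) L2.
  by rewrite ler_norml; apply/andP; split; lra.
move=> y; rewrite lt_min => /andP[yd yx]; have [yx1 yx2] := ltr_normlP _ _ yx.
have [xy|/ltW yx'] := leP x y.
  rewrite (ger0_norm (x := y - x)) ?subr_ge0 //; apply: small => // z /andP[xz zy].
  apply: Hd; rewrite /ball /= ltr0_norm ?subr_lt0 // opprB.
  by apply: le_lt_trans yd; rewrite ger0_norm ?subr_ge0 // lerD2r ltW.
rewrite (ler0_norm (x := y - x)) ?subr_le0 // opprB.
rewrite -normrN opprD opprB -mulrN opprB; apply: small => //; first by lra.
move=> z /andP[yz zx]; apply: Hd; rewrite /ball /= gtr0_norm ?subr_gt0 //.
by apply: lt_trans yd; rewrite ler0_norm ?subr_le0 // opprB ltrD2l ltrN2.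
Qed.

End W2.

(** * The Baskakov basis and its moments *)

Section basis.
Context {R : realType}.
Implicit Types (x s t : R) (n k : nat) (c d : nat -> R).

Lemma baskakov_ge0 n k x : 0 <= x -> 0 <= baskakov n k x.
Proof.
by move=> x0; rewrite /baskakov !mulr_ge0 ?exprn_ge0 ?invr_ge0 ?exprn_ge0 // addr_ge0.
Qed.

Lemma baskakovS n k x : (0 < n)%N ->
  k.+1%:R * baskakov n k.+1 x = n%:R * x * baskakov n.+1 k x.
Proof.
move=> n0; rewrite /baskakov addSn -addnS.
have -> : (n + k.+1 - 1)%N = (n + k)%N by lia.
have := mul_bin_left (n + k) k; rewrite addnK => /(congr1 (fun m => m%:R : R)).
rewrite !natrM exprS => E.
rewrite !mulrA E; ring.
Qed.

Lemma baskakovSn n k x : (0 < n)%N -> 0 <= x ->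
  n%:R * (1 + x) * baskakov n.+1 k x = (n + k)%:R * baskakov n k x.
Proof.
move=> n0 x0; rewrite /baskakov addSn subn1 /=.
have := mul_bin_down (n + k) k; rewrite addnK => /(congr1 (fun m => m%:R : R)).
rewrite !natrM => E.
rewrite subn1 !mulrA E exprS; field.
by rewrite expf_neq0 gt_eqF // ltr_wpDr.
Qed.

(** The step from [n] to [n + 1] is a forward difference in [k]. *)
Lemma baskakov_up n k x : (0 < n)%N -> 0 <= x ->
  n%:R * baskakov n.+1 k x =
  (n + k)%:R * baskakov n k x - k.+1%:R * baskakov n k.+1 x.
Proof. by move=> n0 x0; rewrite baskakovS // -baskakovSn //; ring. Qed.

(** [Dtilde] acts on the basis as a second difference of these weights. *)
Definition weight n k x : R := (k * (n + k))%:R * baskakov n k x.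

Lemma weightS n k x : (0 < n)%N -> 0 <= x ->
  weight n k.+1 x = (n * n.+1)%:R * psi x * baskakov n.+2 k x.
Proof.
move=> n0 x0; rewrite /weight mulnC natrM -mulrA baskakovS // addnS -addSn.
by rewrite mulrCA -baskakovSn // /psi natrM; ring.
Qed.

(** The expectation of [c] under the negative binomial law [baskakov n k x]. *)
Definition bsum n x c s : Prop := series (fun k => c k * baskakov n k x) @ \oo --> s.

Lemma bsumD n x c d s t : bsum n x c s -> bsum n x d t ->
  bsum n x (fun k => c k + d k) (s + t).
Proof.
move=> cs dt; rewrite /bsum.
have -> : series (fun k => (c k + d k) * baskakov n k x) =
    (fun N => series (fun k => c k * baskakov n k x) N +
              series (fun k => d k * baskakov n k x) N).
  by apply/funext => N; rewrite /series /= -big_split /=; apply: eq_bigr => k _; rewrite mulrDl.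
exact: cvgD.
Qed.

Lemma bsumZ n x c a s : bsum n x c s -> bsum n x (fun k => a * c k) (a * s).
Proof.
move=> cs; rewrite /bsum.
have -> : series (fun k => (a * c k) * baskakov n k x) =
    (fun N => a * series (fun k => c k * baskakov n k x) N).
  by apply/funext => N; rewrite /series /= big_distrr /=; apply: eq_bigr => k _; rewrite mulrA.
by apply: cvgM => //; exact: cvg_cst.
Qed.

Lemma eq_bsum n x c d s : c =1 d -> bsum n x c s -> bsum n x d s.
Proof. by move=> /funext ->. Qed.

(** A factor [k] raises [n] and lowers [k], which yields the factorial moments. *)
Lemma bsum_mulk n x c s : (0 < n)%N -> bsum n.+1 x (fun k => c k.+1) s ->
  bsum n x (fun k => k%:R * c k) (n%:R * x * s).
Proof.
move=> n0 cs; rewrite /bsum -(cvg_shiftS (series _)) /=.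
rewrite [X in X @ _ --> _](_ : _ = (fun N => n%:R * x *
    series (fun k => c k.+1 * baskakov n.+1 k x) N)); last first.
  apply/funext => N; rewrite /series /= big_nat_recl // !mul0r add0r big_distrr /=.
  by apply: eq_bigr => k _; rewrite mulrAC baskakovS //; ring.
by apply: cvgM => //; exact: cvg_cst.
Qed.

Lemma baskakov1 k x : baskakov 1 k x = (1 + x)^-1 * (x / (1 + x)) ^+ k.
Proof.
by rewrite /baskakov addnC addnK binn mul1r addn1 exprMn exprVn exprS invfM; ring.
Qed.

(** Summing [baskakov_up], the forward differences telescope. *)
Lemma baskakov_partial_up n N x : (0 < n)%N -> 0 <= x ->
  series (fun k => baskakov n.+1 k x) N =
  series (fun k => baskakov n k x) N - N%:R * baskakov n N x / n%:R.
Proof.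
move=> n0 x0; have n0' : n%:R != 0 :> R by rewrite pnatr_eq0 -lt0n.
elim: N => [|N IH]; first by rewrite /series /= !big_nil !mul0r subr0.
rewrite !seriesSr /= in IH *.
rewrite IH; have := baskakov_up N n0 x0 => H.
have -> : baskakov n.+1 N x = ((n + N)%:R * baskakov n N x - N.+1%:R * baskakov n N.+1 x) / n%:R.
  by rewrite -H mulrC mulKf.
by rewrite natrD; field.
Qed.

Lemma baskakov_partial_le1 n N x : (0 < n)%N -> 0 <= x ->
  series (fun k => baskakov n k x) N <= 1.
Proof.
case: n => // n _ x0; elim: n => [|n IH]; last first.
  rewrite baskakov_partial_up //; apply: le_trans IH; rewrite lerBlDr lerDl.
  by rewrite divr_ge0 // mulr_ge0 // baskakov_ge0.
have x1 : 1 + x != 0 by rewrite gt_eqF // ltr_wpDr.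
have -> : series (fun k => baskakov 1 k x) N = 1 - (x / (1 + x)) ^+ N.
  elim: N => [|N IH]; first by rewrite /series /= big_nil expr0 subrr.
  by rewrite seriesSr /= IH baskakov1 exprS; field.
by rewrite lerBlDr lerDl exprn_ge0 // divr_ge0 // addr_ge0.
Qed.

Lemma cvg_baskakov_series n x : (0 < n)%N -> 0 <= x ->
  cvgn (series (fun k => baskakov n k x)).
Proof.
move=> n0 x0; apply: nondecreasing_is_cvgn.
  by apply/nondecreasing_seqP => N; rewrite seriesSr lerDl baskakov_ge0.
by exists 1 => _ [N _ <-]; exact: baskakov_partial_le1.
Qed.

Lemma cvg_baskakov0 n x : (0 < n)%N -> 0 <= x -> baskakov n k x @[k --> \oo] --> (0 : R).
Proof. by move=> n0 x0; apply: cvg_series_cvg_0; exact: cvg_baskakov_series. Qed.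

Lemma cvg_baskakovM0 n x : (0 < n)%N -> 0 <= x ->
  k%:R * baskakov n k x @[k --> \oo] --> (0 : R).
Proof.
move=> n0 x0; rewrite -(cvg_shiftS (fun k => k%:R * baskakov n k x)) /=.
have -> : (fun k => k.+1%:R * baskakov n k.+1 x) =
    (fun k => n%:R * x * baskakov n.+1 k x) by apply/funext => k; rewrite baskakovS.
have := cvgM (cvg_cst (n%:R * x)) (cvg_baskakov0 (ltn0Sn n) x0).
by rewrite mulr0; exact.
Qed.

(** The boundary term in [baskakov_partial_up] tends to 0, so the total mass does not
depend on [n]; for [n = 1] the series is geometric. *)
Lemma bsum1 n x : (0 < n)%N -> 0 <= x -> bsum n x (fun=> 1) 1.
Proof.
case: n => // n _ x0; rewrite /bsum; under eq_fun do rewrite mul1r.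
elim: n => [|n IH].
  have x1 : 0 < 1 + x by rewrite ltr_wpDr.
  have -> : series (fun k => baskakov 1 k x) = (fun N => 1 - (x / (1 + x)) ^+ N).
    apply/funext; elim => [|N IH]; first by rewrite /series /= big_nil expr0 subrr.
    by rewrite seriesSr /= IH baskakov1 exprS; field; rewrite gt_eqF.
  have q1 : `|x / (1 + x)| < 1.
    rewrite ger0_norm ?divr_ge0 // ?ltW //.
    by rewrite ltr_pdivrMr // mul1r ltrDr.
  have := cvgB (cvg_cst (1 : R)) (cvg_expr q1); rewrite subr0; exact.
have -> : series (fun k => baskakov n.+2 k x) = (fun N =>
   series (fun k => baskakov n.+1 k x) N - N%:R * baskakov n.+1 N x * n.+1%:R^-1).
  by apply/funext => N; rewrite baskakov_partial_up.
have := cvgB IH (cvgM (cvg_baskakovM0 (ltn0Sn n) x0) (cvg_cst (n.+1%:R^-1 : R))).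
by rewrite mul0r subr0; exact.
Qed.

(** The combinations of moments are those expressing powers through falling
factorials: [k^3 = k_3 + 3 k_2 + k_1] and [k^4 = k_4 + 6 k_3 + 7 k_2 + k_1]. *)
Lemma bsum_moments n x (a0 a1 a2 a3 a4 : R) : (0 < n)%N -> 0 <= x ->
  let N : R := n%:R in
  let m1 := N * x in let m2 := N * x * ((N + 1) * x) in
  let m3 := m2 * ((N + 2) * x) in let m4 := m3 * ((N + 3) * x) in
  bsum n x (fun k => let k := k%:R : R in
      a0 + a1 * k + a2 * k ^+ 2 + a3 * k ^+ 3 + a4 * k ^+ 4)
    (a0 + a1 * m1 + a2 * (m2 + m1) + a3 * (m3 + 3 * m2 + m1) +
     a4 * (m4 + 6 * m3 + 7 * m2 + m1)).
Proof.
move=> n0 x0 N m1 m2 m3 m4.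
pose f1 k : R := k%:R. pose f2 k : R := k%:R * (k%:R - 1).
pose f3 k : R := f2 k * (k%:R - 2). pose f4 k : R := f3 k * (k%:R - 3).
have S1 j : (0 < j)%N -> bsum j x f1 (j%:R * x).
  move=> j0; rewrite -[X in bsum _ _ _ X]mulr1.
  by apply: (eq_bsum _ (bsum_mulk j0 (c := fun=> 1) (bsum1 _ x0))) => // k; rewrite mulr1.
have S2 j : (0 < j)%N -> bsum j x f2 (j%:R * x * (j.+1%:R * x)).
  move=> j0; apply: (bsum_mulk j0 (c := fun k => k%:R - 1)).
  by apply: (eq_bsum _ (S1 j.+1 _)) => // k; rewrite -natr1 addrK.
have S3 j : (0 < j)%N -> bsum j x f3 (j%:R * x * (j.+1%:R * x * (j.+2%:R * x))).
  move=> j0.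
  apply: (eq_bsum _ (bsum_mulk j0 (c := fun k => (k%:R - 1) * (k%:R - 2)) _)) => //.
    by move=> k; rewrite /f3 /f2; ring.
  by apply: (eq_bsum _ (S2 j.+1 _)) => // k; rewrite /f2 -natr1; ring.
have S4 : bsum n x f4 (n%:R * x * (n.+1%:R * x * (n.+2%:R * x * (n.+3%:R * x)))).
  apply: (eq_bsum _ (bsum_mulk n0 (c := fun k => (k%:R - 1) * (k%:R - 2) * (k%:R - 3)) _)) => //.
    by move=> k; rewrite /f4 /f3 /f2; ring.
  by apply: (eq_bsum _ (S3 n.+1 _)) => // k; rewrite /f3 /f2 -natr1; ring.
have := bsumD (bsumD (bsumD (bsumD (bsumZ (a := a0) (bsum1 n0 x0)) (bsumZ (a := a1 + a2 + a3 + a4) (S1 n n0)))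
   (bsumZ (a := a2 + 3 * a3 + 7 * a4) (S2 n n0))) (bsumZ (a := a3 + 6 * a4) (S3 n n0))) (bsumZ (a := a4) S4).
set s := (X in bsum _ _ _ X); set s' := (X in _ -> bsum _ _ _ X).
have -> : s' = s.
  by rewrite /s /s' /m4 /m3 /m2 /m1 /N -[n.+3%:R]natr1 -[n.+2%:R]natr1 -[n.+1%:R]natr1; ring.
apply: eq_bsum => k; rewrite /f4 /f3 /f2 /f1; ring.
Qed.

End basis.

Section deriv.
Context {R : realType}.
Implicit Types (x s t : R) (n k : nat).

Lemma is_derive_baskakov n k x : 0 < x ->
  is_derive x 1 (baskakov n k) ((k%:R - n%:R * x) * baskakov n k x / psi x).
Proof.
move=> x0; have x10 : 0 < 1 + x by rewrite addr_gt0.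
have x1 : 1 + x != 0 by rewrite gt_eqF.
have d1x : is_derive x 1 (fun y : R => 1 + y) 1.
  by have := is_deriveD (is_derive_cst (1 : R) x 1) (is_derive_id x 1); rewrite add0r.
have dX := is_deriveX k (is_derive_id x 1).
have dY := is_deriveX (n + k) d1x.
have y0 : ((fun y : R => 1 + y) ^+ (n + k)) x != 0.
  by rewrite exprfctE expf_neq0.
have dV := is_deriveV y0 dY.
have dM := is_deriveM (is_deriveM (is_derive_cst ('C((n + k - 1)%N, k)%:R : R) x 1) dX) dV.
have -> : baskakov n k = (cst 'C((n + k - 1)%N, k)%:R * id ^+ k) *
    (fun y => (((fun y : R => 1 + y) ^+ (n + k)) y)^-1).
  by apply/funext => y; rewrite !fctE.
apply: is_derive_eq.
have powE (m : nat) (z : R) : z != 0 -> m%:R * z ^+ m.-1 = m%:R * z ^+ m / z.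
  by case: m => [|m] z0; rewrite ?mul0r // exprS; field.
rewrite !fctE /GRing.scale /= !mulr1 mulr0 addr0 !powE ?gt_eqF // /psi !natrD.
by field; rewrite expf_neq0 ?gt_eqF.
Qed.

Lemma derive1_baskakov n k x : 0 < x ->
  derive1 (baskakov n k) x = (k%:R - n%:R * x) * baskakov n k x / psi x.
Proof.
by move=> x0; rewrite derive1E; have := is_derive_baskakov n k x0 => ?; exact: derive_val.
Qed.

Lemma near_pos x : 0 < x -> \forall y \near x, 0 < y.
Proof. by move=> x0; exact: lt_nbhsr. Qed.

(** Both sides are [psi] times the second derivative of [baskakov n k]; neighbouring
basis functions are multiples of [baskakov n k] by rational functions of [x]. *)
Lemma weight_second_difference n k x : (0 < n)%N -> 0 < x ->
  weight n k.-1 x - 2 * weight n k x + weight n k.+1 x =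
  ((k%:R - n%:R * x) * (k%:R - n%:R * x - 1 - 2 * x) / psi x - n%:R) * baskakov n k x.
Proof.
move=> n0 x0; have x10 : 0 < 1 + x by rewrite addr_gt0.
have x1 : 1 + x != 0 by rewrite gt_eqF.
have xn0 : x != 0 by rewrite gt_eqF.
have n0' : n%:R != 0 :> R by rewrite pnatr_eq0 -lt0n.
have up j : j.+1%:R * baskakov n j.+1 x = (n + j)%:R * (x / (1 + x)) * baskakov n j x.
  have E : baskakov n.+1 j x = (n + j)%:R * baskakov n j x / (n%:R * (1 + x)).
    by rewrite -baskakovSn ?ltW //; field; rewrite ?n0' ?x1 ?xn0.
  by rewrite baskakovS // E; field; rewrite ?n0' ?x1 ?xn0.
have wS : weight n k.+1 x = (n + k.+1)%:R * (n + k)%:R * (x / (1 + x)) * baskakov n k x.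
  transitivity ((n + k.+1)%:R * (k.+1%:R * baskakov n k.+1 x)).
    by rewrite /weight natrM; ring.
  by rewrite up; ring.
rewrite wS /psi; case: k {wS} => [|j] /=.
  by rewrite /weight mul0n !mul0r !addn0 addn1 -natr1; field; rewrite ?n0' ?x1 ?xn0.
have -> : weight n j x = j%:R * j.+1%:R * ((1 + x) / x) * baskakov n j.+1 x.
  transitivity (j%:R * ((1 + x) / x) * (j.+1%:R * baskakov n j.+1 x)); last by ring.
  by rewrite up /weight natrM; field; rewrite ?n0' ?x1 ?xn0.
rewrite /weight !addnS !natrM -![_.+1%:R]natr1 natrD; field; rewrite ?n0' ?x1 ?xn0 //.
Qed.

Lemma is_derive_derive1_baskakov n k x : (0 < n)%N -> 0 < x ->
  is_derive x 1 (derive1 (baskakov n k))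
    ((weight n k.-1 x - 2 * weight n k x + weight n k.+1 x) / psi x).
Proof.
move=> n0 x0; have x10 : 0 < 1 + x by rewrite addr_gt0.
have p0 : psi x != 0 by rewrite gt_eqF // psi_gt0.
pose F (y : R) : R := (k%:R - n%:R * y) * baskakov n k y / psi y.
have nearE : \forall y \near x, F y = derive1 (baskakov n k) y.
  by apply: filterS (near_pos x0) => y y0; rewrite derive1_baskakov.
apply: near_eq_is_derive nearE _.
have dP := is_derive_baskakov n k x0.
have dpsi : is_derive x 1 (psi : R -> R) (1 + 2 * x).
  have := is_deriveM (is_derive_id x 1) (is_deriveD (is_derive_cst (1 : R) x 1) (is_derive_id x 1)).
  by move=> d; apply: (is_derive_eq d); rewrite /GRing.scale /= !fctE /=; ring.
have dl : is_derive x 1 (fun y => k%:R - n%:R * y) (- n%:R).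
  have := is_deriveB (is_derive_cst (k%:R : R) x 1) (is_deriveZ n%:R (is_derive_id x 1)).
  by move=> d; apply: (is_derive_eq d); rewrite /GRing.scale /=; ring.
have := is_deriveM (is_deriveM dl dP) (is_deriveV p0 dpsi).
move=> d; apply: (is_derive_eq d).
rewrite weight_second_difference // /GRing.scale /= !fctE /= /psi in p0 *.
by field; rewrite !gt_eqF.
Qed.

Lemma Dtilde_baskakov n k x : (0 < n)%N -> 0 < x ->
  Dtilde (baskakov n k) x = weight n k.-1 x - 2 * weight n k x + weight n k.+1 x.
Proof.
move=> n0 x0; rewrite /Dtilde /= derive1E.
have := is_derive_derive1_baskakov k n0 x0 => ?; rewrite derive_val.
by rewrite mulrC divfK // gt_eqF // psi_gt0.
Qed.

(** [q] has mean 1 and second moment [3 + 2 / n] under the law [baskakov n k x], and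
[|2 - q| <= ((2 - q)^2 + 4) / 4]. *)
Lemma series_norm_Ptilde_le2 n N x : (2 <= n)%N -> 0 < x ->
  series (fun k => `|Ptilde n k x|) N <= 2.
Proof.
move=> n2 x0; have n0 : (0 < n)%N by exact: ltnW.
have n0' : 0 < n%:R :> R by rewrite ltr0n.
have ps := psi_gt0 x0.
pose D : R := n%:R * psi x. pose a : R := 1 + 2 * x.
pose b : R := 2 * n%:R * x + a. pose c : R := n%:R * x * (n%:R * x + a).
have D0 : D != 0 by rewrite gt_eqF // mulr_gt0.
pose q k : R := (k%:R ^+ 2 - b * k%:R + c) / D.
have PE k : Ptilde n k x = (2 - q k) * baskakov n k x.
  rewrite /Ptilde Dtilde_baskakov // weight_second_difference // /q /c /b /a /D.
  by field; rewrite !gt_eqF.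
have := @bsum_moments R n x ((4 - 4 * c / D + c ^+ 2 / D ^+ 2 + 4) / 4)
  ((4 * b / D - 2 * b * c / D ^+ 2) / 4)
  ((- 4 / D + (b ^+ 2 + 2 * c) / D ^+ 2) / 4) (- 2 * b / D ^+ 2 / 4) (D ^- 2 / 4) n0 (ltW x0).
rewrite /=; set s := (X in bsum _ _ _ X) => Hs.
have sle : s <= 2.
  have -> : s = 2 + (2 / n%:R - 1) / 4.
    by rewrite /s /c /b /a /D /psi; field; rewrite !gt_eqF // addr_gt0.
  rewrite gerDl pmulr_lle0 ?invr_gt0 // subr_le0 ler_pdivrMr // mul1r.
  by rewrite (ler_nat _ 2 n).
have Hs' : bsum n x (fun k => ((2 - q k) ^+ 2 + 4) / 4) s.
  apply: eq_bsum Hs => k; rewrite /q; field; exact: D0.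
apply: le_trans sle; rewrite -(cvg_lim _ Hs') //.
apply: (@le_trans _ _ (series (fun k => ((2 - q k) ^+ 2 + 4) / 4 * baskakov n k x) N)).
  apply: ler_sum => k _; rewrite PE normrM (ger0_norm (baskakov_ge0 _ _ (ltW x0))).
  apply: ler_wpM2r; first by apply: baskakov_ge0; exact: ltW.
  rewrite ler_pdivlMr //.
  have := sqr_ge0 (`|2 - q k| - 2); rewrite sqrrB real_normK ?num_real //; lra.
apply: nondecreasing_cvgn_le; last by apply/cvg_ex; exists s; exact: Hs'.
apply/nondecreasing_seqP => m; rewrite seriesSr lerDl; apply: mulr_ge0; last by apply: baskakov_ge0; exact: ltW.
by rewrite divr_ge0 // addr_ge0 // sqr_ge0.
Qed.

End deriv.

(** * Improper integrals over the half-line *)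

Section halfline.
Context {R : realType}.
Implicit Types (x t : R) (n k j : nat) (u f F h : R -> R).
Local Notation mu := (@lebesgue_measure R).
Local Notation D := (`]0, +oo[%classic : set R).
Local Notation integrable0y u := (mu.-integrable D (EFin \o u)).

Lemma measurable_fun_halfline u : (forall x, 0 < x -> {for x, continuous u}) ->
  measurable_fun D u.
Proof.
move=> uc; apply: open_continuous_measurable_fun => //.
by move=> x; rewrite inE /= in_itv /= andbT; exact: uc.
Qed.

Lemma le_integrable_halfline u f : (forall x, 0 < x -> {for x, continuous u}) ->
  (forall x, 0 < x -> `|u x| <= f x) -> integrable0y f -> integrable0y u.
Proof.
move=> uc uf; apply: le_integrable => //.
  by apply/measurable_EFinP; exact: measurable_fun_halfline.
move=> x /=; rewrite in_itv /= andbT lee_fin => /uf ufx.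
exact: le_trans ufx (ler_norm _).
Qed.

(** Exhausting the half-line by compact intervals, by dominated convergence. *)
Lemma Rintegral_halfline_cvg u : integrable0y u ->
  \int[mu]_(t in `[n.+1%:R^-1, n.+1%:R]) u t @[n --> \oo] -->
  \int[mu]_(t in D) u t.
Proof.
move=> ui; pose I n : set R := `[n.+1%:R^-1, n.+1%:R]%classic.
have mI n : measurable (I n) by exact: measurable_itv.
have I0 n : I n `<=` D.
  move=> x; rewrite /I /= !in_itv /= andbT => /andP[+ _].
  by apply: lt_le_trans; rewrite invr_gt0.
have mu0 : measurable_fun D (EFin \o u) by case/integrableP: ui.
pose v n := (EFin \o u) \_ (I n).
have [] := @dominated_convergence _ _ _ mu D
  (measurable_itv _) v (EFin \o u) (abse \o (EFin \o u)).
- move=> n; apply/(measurable_restrict _ (mI n)) => //.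
  by apply: measurable_funS mu0 => // x [].
- by [].
- apply: aeW => x /=; rewrite in_itv /= andbT => x0.
  apply: cvg_near_cst.
  have [N xN] : exists N : nat, x <= N%:R.
    by exists (Num.truncn x).+1; rewrite ltW // truncnS_gt.
  have [N' xN'] : exists N : nat, x^-1 <= N%:R.
    by exists (Num.truncn x^-1).+1; rewrite ltW // truncnS_gt.
  near=> n; rewrite /v patchE mem_set // /I /= in_itv /=; apply/andP; split.
    rewrite invf_ple ?posrE //; apply: (le_trans xN'); rewrite ler_nat leqW //.
    by near: n; exact: nbhs_infty_ge.
  apply: (le_trans xN); rewrite ler_nat leqW //.
  by near: n; exact: nbhs_infty_ge.
- exact: integrable_abse.
- apply: aeW => x n _; rewrite /v patchE; case: ifPn => // _.
  by rewrite (_ : point = 0%E) // abse0 abse_ge0.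
move=> iu _ cv; rewrite /Rintegral; apply: fine_cvg.
rewrite fineK; last exact: integrable_fin_num iu.
move: cv; rewrite (_ : [sequence _]_n = (fun n => \int[mu]_(t in I n) (u t)%:E)%E) //.
apply/funext => n; rewrite /v -[in RHS](setIidr (I0 n)) integral_mkcondr //.
Unshelve. all: by end_near. Qed.

Lemma continuous_halfline_itv (a b : R) u : 0 < a ->
  (forall x, 0 < x -> {for x, continuous u}) -> {within `[a, b], continuous u}.
Proof.
move=> a0 uc; apply: continuous_in_subspaceT => x.
by rewrite inE /= in_itv /= => /andP[ax _]; apply: uc; exact: lt_le_trans ax.
Qed.

Lemma is_derive_continuous F x (l : R) : is_derive x 1 F l -> {for x, continuous F}.
Proof.
by move=> dF; apply: differentiable_continuous; apply/derivable1_diffP; exact: ex_derive.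
Qed.

(** The comparison holds on compact intervals and passes to the limit. It bounds
integrals by explicit functions when no primitive of the integrand is at hand. *)
Lemma Rintegral_halfline_le u F f (l0 l1 : R) :
  (forall x, 0 < x -> {for x, continuous u}) ->
  (forall x, 0 < x -> {for x, continuous f}) ->
  (forall x, 0 < x -> is_derive x 1 F (f x)) ->
  (forall x, 0 < x -> u x <= f x) -> integrable0y u ->
  F x @[x --> 0^'+] --> l0 -> F x @[x --> +oo] --> l1 ->
  \int[mu]_(t in D) u t <= l1 - l0.
Proof.
move=> uc fc dF uf ui F0 F1.
have inv_cvg : ((n.+1%:R^-1 : R) @[n --> \oo] --> (0 : R)) by exact: cvg_harmonic.
have nat_cvg : ((n.+1%:R : R) @[n --> \oo] --> +oo).
  by rewrite (cvg_shiftS (fun n => n%:R : R)); exact: cvgr_idn.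
have Fa : F n.+1%:R^-1 @[n --> \oo] --> l0.
  by apply: ((cvg_at_rightP _ _ _).1 F0 (fun n => n.+1%:R^-1)); split.
have Fb := (cvg_pinftyP _ _).1 F1 _ nat_cvg.
apply: ler_cvg_to (Rintegral_halfline_cvg ui) (cvgB Fb Fa) _.
near=> n.
have ab : (n.+1%:R^-1 : R) < n.+1%:R.
  have n1 : (1 : R) < n.+1%:R.
    by rewrite ltr1n ltnS; near: n; exact: nbhs_infty_gt.
  by apply: (lt_trans _ n1); rewrite invf_lt1 // (lt_trans _ n1).
have a0 : (0 : R) < n.+1%:R^-1 by rewrite invr_gt0.
set a := n.+1%:R^-1 in ab a0 *; set b := n.+1%:R in ab *.
have FTC : (\int[mu]_(x in `[a, b]) (f x)%:E = (F b)%:E - (F a)%:E)%E.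
  have Fc x : 0 < x -> {for x, continuous F} by move=> x0; exact: is_derive_continuous (dF x x0).
  apply: continuous_FTC2 => //.
  - exact: continuous_halfline_itv.
  - split.
    + move=> x; rewrite in_itv /= => /andP[ax xb]; apply: ex_derive.
      by apply: dF; exact: lt_trans ax.
    + by apply: cvg_within_filter; exact: Fc.
    + by apply: cvg_within_filter; apply: Fc; exact: lt_trans ab.
  - move=> x; rewrite in_itv /= => /andP[ax xb]; rewrite derive1E.
    by apply: derive_val; apply: dF; exact: lt_trans ax.
have ci g : (forall x, 0 < x -> {for x, continuous g}) -> mu.-integrable `[a, b] (EFin \o g).
  move=> gc; apply: continuous_compact_integrable; first exact: segment_compact.
  exact: continuous_halfline_itv.
have E : F b - F a = \int[mu]_(t in `[a, b]) f t by rewrite /Rintegral FTC.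
rewrite [leRHS]E.
apply: le_Rintegral => //; [exact: ci|exact: ci|].
by move=> x /=; rewrite in_itv /= => /andP[ax _]; apply: uf; exact: lt_le_trans ax.
Unshelve. all: by end_near. Qed.

Lemma Rintegral_halfline_eq u F (l0 l1 : R) :
  (forall x, 0 < x -> {for x, continuous u}) ->
  (forall x, 0 < x -> is_derive x 1 F (u x)) -> integrable0y u ->
  F x @[x --> 0^'+] --> l0 -> F x @[x --> +oo] --> l1 ->
  \int[mu]_(t in D) u t = l1 - l0.
Proof.
move=> uc dF ui F0 F1; apply/eqP; rewrite eq_le; apply/andP; split.
  by apply: (Rintegral_halfline_le uc uc dF _ ui F0 F1).
rewrite -lerN2 opprB -[leLHS]mulN1r -RintegralZl //.
have := @Rintegral_halfline_le (fun x => -1 * u x) (\- F) (fun x => -1 * u x) (- l0) (- l1).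
rewrite opprK [- l1 + l0]addrC; apply.
- by move=> x x0; apply: cvgM; [exact: cvg_cst|exact: uc].
- by move=> x x0; apply: cvgM; [exact: cvg_cst|exact: uc].
- by move=> x x0; have ? := dF x x0; rewrite mulN1r; exact: is_deriveN.
- by [].
- have /(_ (measurable_itv _)) H := integrableZl _ (-1) ui.
  exact H.
- exact: cvgN.
- exact: cvgN.
Qed.

End halfline.

(** * Integrals of the basis *)

Section baskakov_integrals.
Context {R : realType}.
Implicit Types (x t : R) (n k j m : nat) (u f F h : R -> R).
Local Notation mu := (@lebesgue_measure R).
Local Notation D := (`]0, +oo[%classic : set R).
Local Notation integrable0y u := (mu.-integrable D (EFin \o u)).

Lemma integrable_halflineZ (c : R) u : integrable0y u -> integrable0y (fun x => c * u x).
Proof.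
move=> ui; have /(_ (measurable_itv _)) H := integrableZl _ c ui.
exact H.
Qed.

Lemma continuous_baskakov n k x : 0 < x -> {for x, continuous (baskakov n k)}.
Proof. by move=> x0; exact: is_derive_continuous (is_derive_baskakov n k x0). Qed.

(** Functions tending to 0 at both ends of the half-line: the boundary terms
of the integrations by parts. *)
Definition vanishing F := F x @[x --> 0^'+] --> (0 : R) /\ F x @[x --> +oo] --> (0 : R).

Lemma vanishingD F f : vanishing F -> vanishing f -> vanishing (fun x => F x + f x).
Proof.
move=> [F0 F1] [f0 f1]; split.
  by have := cvgD F0 f0; rewrite addr0; exact.
by have := cvgD F1 f1; rewrite addr0; exact.
Qed.

Lemma vanishingZ (c : R) F : vanishing F -> vanishing (fun x => c * F x).
Proof.
move=> [F0 F1]; split.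
  by have := cvgM (cvg_cst c) F0; rewrite mulr0; exact.
by have := cvgM (cvg_cst c) F1; rewrite mulr0; exact.
Qed.

Lemma le_vanishing F f : (forall x, 0 < x -> `|F x| <= f x) -> vanishing f -> vanishing F.
Proof.
move=> Ff [f0 f1]; split.
  apply/norm_cvg0P; apply: (squeeze_cvgr _ (cvg_cst 0) f0).
  by near=> x; rewrite normr_ge0 Ff //; near: x; exact: nbhs_right_gt.
apply/norm_cvg0P; apply: (squeeze_cvgr _ (cvg_cst 0) f1).
by near=> x; rewrite normr_ge0 Ff //; near: x; exact: nbhs_pinfty_gt.
Unshelve. all: by end_near. Qed.

Lemma vanishing_sqrt : vanishing (fun x => Num.sqrt x / (1 + x)).
Proof.
split; apply/cvgr0Pnorm_le => e e0.
  near=> x; have x0 : 0 < x by near: x; exact: nbhs_right_gt.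
  have xe : x < e ^+ 2 by near: x; apply: nbhs_right_lt; rewrite exprn_gt0.
  have x1 : 0 < 1 + x by rewrite addr_gt0.
  rewrite ger0_norm ?divr_ge0 ?sqrtr_ge0 ?(ltW x0) ?(ltW x1) //.
  rewrite ler_pdivrMr //; apply: (@le_trans _ _ e).
    by rewrite -(ger0_norm (ltW e0)) -sqrtr_sqr ler_sqrt ?sqr_ge0 ?ltW.
  by rewrite ler_pMr // lerDl ltW.
near=> x; have x0 : 0 < x by near: x; exact: nbhs_pinfty_gt.
have xe : (e ^-1) ^+ 2 < x by near: x; apply: nbhs_pinfty_gt; exact: num_real.
have x1 : 0 < 1 + x by rewrite addr_gt0.
have s0 : 0 < Num.sqrt x by rewrite sqrtr_gt0.
rewrite ger0_norm ?divr_ge0 ?sqrtr_ge0 ?(ltW x0) ?(ltW x1) // ler_pdivrMr //.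
apply: (@le_trans _ _ (e * x)); last by rewrite ler_pM2l // lerDr.
rewrite -{2}(sqr_sqrtr (ltW x0)) expr2 mulrA ler_pMl // -ler_pdivrMl // mulr1.
have ei0 : 0 <= e^-1 by rewrite invr_ge0 ltW.
by rewrite -(ger0_norm ei0) -sqrtr_sqr ler_sqrt // ltW.
Unshelve. all: by end_near. Qed.

Lemma baskakovS_bound n k : (0 < n)%N -> exists2 C : R, 0 <= C &
  forall x, 0 < x -> baskakov n k.+1 x <= C * (x / (1 + x) ^+ 2).
Proof.
move=> n0; exists 'C((n + k.+1 - 1)%N, k.+1)%:R => // x x0.
have x1 : 1 + x != 0 by rewrite gt_eqF // addr_gt0.
have q1 : x / (1 + x) <= 1 by rewrite ler_pdivrMr ?addr_gt0 // mul1r lerDr.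
have q0 : 0 <= x / (1 + x) by rewrite divr_ge0 // ltW // addr_gt0.
rewrite /baskakov -mulrA ler_wpM2l //.
have -> : x ^+ k.+1 / (1 + x) ^+ (n + k.+1) =
   x / (1 + x) ^+ 2 * ((x / (1 + x)) ^+ k * ((1 + x)^-1) ^+ n.-1).
  case: n n0 => // p _; rewrite /= addSn addnS !exprS exprD exprMn !exprVn.
  by field; rewrite ?expf_neq0.
rewrite ger_pMr; last by rewrite divr_gt0 // exprn_gt0 // addr_gt0.
apply: mulr_ile1; rewrite ?exprn_ge0 ?invr_ge0 ?exprn_ile1 ?invr_ge0 //; try lra.
by rewrite invf_le1; lra.
Qed.

Lemma baskakov_bound n k : exists2 C : R, 0 <= C &
  forall x, 0 < x -> baskakov n k x <= C * (1 + x) ^- n.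
Proof.
exists 'C((n + k - 1)%N, k)%:R => // x x0.
have x1 : 1 + x != 0 by rewrite gt_eqF // addr_gt0.
have q1 : x / (1 + x) <= 1 by rewrite ler_pdivrMr ?addr_gt0 // mul1r lerDr.
have q0 : 0 <= x / (1 + x) by rewrite divr_ge0 // ltW // addr_gt0.
rewrite /baskakov -mulrA ler_wpM2l //.
have -> : x ^+ k / (1 + x) ^+ (n + k) = (1 + x) ^- n * (x / (1 + x)) ^+ k.
  by rewrite exprD exprMn exprVn; field; rewrite ?expf_neq0.
by rewrite ger_pMr ?invr_gt0 ?exprn_gt0 ?addr_gt0 // exprn_ile1.
Qed.

Lemma ratio_le_sqrt x : 0 < x -> x / (1 + x) <= Num.sqrt x.
Proof.
move=> x0; have x1 : 0 < 1 + x by rewrite addr_gt0.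
rewrite ler_pdivrMr //; have s0 := sqrtr_ge0 x.
have xE := sqr_sqrtr (ltW x0); have := sqr_ge0 (Num.sqrt x - 1); nra.
Qed.

Lemma vanishing_ratio : vanishing (fun x => x / (1 + x) ^+ 2).
Proof.
apply: le_vanishing vanishing_sqrt => x x0; have x1 : 0 < 1 + x by rewrite addr_gt0.
rewrite ger0_norm ?divr_ge0 ?exprn_ge0 ?(ltW x0) ?(ltW x1) // expr2 invfM mulrA.
by rewrite ler_wpM2r ?invr_ge0 ?(ltW x1) ?ratio_le_sqrt.
Qed.

Lemma vanishing_baskakovS n k : (0 < n)%N -> vanishing (baskakov n k.+1).
Proof.
move=> n0; have [C C0 H] := baskakovS_bound k n0.
apply: le_vanishing (vanishingZ C vanishing_ratio) => x x0.
by rewrite ger0_norm ?baskakov_ge0 ?(ltW x0) ?(ltW x1) // H.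
Qed.

Lemma cvg_pinfty_baskakov n k : (0 < n)%N -> baskakov n k x @[x --> +oo] --> (0 : R).
Proof.
case: k => [|k] n0; last exact: (vanishing_baskakovS k n0).2.
have [C C0 H] := baskakov_bound n 0.
apply/norm_cvg0P; apply: (@squeeze_cvgr _ _ _ _ (cst 0) (fun x => C * (Num.sqrt x / (1 + x)))).
- near=> x; rewrite normr_ge0 /=.
  have x0 : 0 < x by near: x; exact: nbhs_pinfty_gt.
  have x1 : 1 <= x by near: x; exact: nbhs_pinfty_ge.
  rewrite ger0_norm ?baskakov_ge0 ?(ltW x0) ?(ltW x1) //; apply: le_trans (H x x0) _.
  rewrite ler_wpM2l // -(prednK n0) exprS invfM mulrC.
  rewrite ler_wpM2r ?invr_ge0 ?addr_ge0 ?(ltW x0) ?(ltW x1) //.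
  apply: (@le_trans _ _ 1).
    by rewrite invf_le1 ?exprn_gt0 ?addr_gt0 // exprn_ege1 // lerDl ltW.
  by rewrite -sqrtr1 ler_sqrt // ltW.
- exact: cvg_cst.
- by have := (vanishingZ C vanishing_sqrt).2.
Unshelve. all: by end_near. Qed.

Lemma integrable_oneDX2V : integrable0y (fun x => (1 + x) ^- 2).
Proof.
pose F x := - (1 + x)^-1.
have pos x : 0 <= x -> 0 < 1 + x by move=> x0; rewrite ltr_wpDr.
have dF x : 0 <= x -> is_derive x 1 F ((1 + x) ^- 2).
  move=> /pos x1.
  have d1 : is_derive x 1 (fun y : R => 1 + y) 1.
    by have := is_deriveD (is_derive_cst (1 : R) x 1) (is_derive_id x 1); rewrite add0r.
  have x1n : (fun y : R => 1 + y) x != 0 by rewrite gt_eqF.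
  apply: (is_derive_eq (is_deriveN (is_deriveV x1n d1))).
  by rewrite /GRing.scale /= mulr1 opprK.
have c x : 0 <= x -> {for x, continuous (fun x => (1 + x) ^- 2)}.
  move=> /pos x1; apply: cvgV; first by rewrite expf_neq0 // gt_eqF.
  by apply: (@continuous_comp _ _ _ (fun y : R => 1 + y) (fun y => y ^+ 2));
   [apply: cvgD => //; exact: cvg_cst|exact: exprn_continuous].
have cw : {within `[0, +oo[, continuous (fun x => (1 + x) ^- 2)}.
  by apply: continuous_in_subspaceT => x; rewrite inE /= in_itv /= andbT; exact: c.
have F1 : F x @[x --> +oo] --> 0.
  have := cvg_pinfty_baskakov 0 (ltn0Sn 0) => /cvgN; rewrite oppr0.
  have -> : - baskakov 1 0 = F :> (R -> R); last by [].
  by apply/funext => x; rewrite !fctE /F /baskakov bin0 expr0 !mul1r.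
have FTC := @ge0_continuous_FTC2y R (fun x => (1 + x) ^- 2) F 0 0.
have {}FTC : (\int[mu]_(x in `[0%R, +oo[) ((1 + x) ^- 2)%:E = 0%:E - (F 0)%:E)%E.
  apply: FTC => //.
  - by move=> x x0; rewrite invr_ge0 exprn_ge0 // ltW // pos.
  - by move=> x x0; apply: ex_derive; apply: dF; exact: ltW.
  - by apply: cvg_within_filter; apply: is_derive_continuous (dF 0 _).
  - move=> x; rewrite in_itv /= andbT => x0; rewrite derive1E.
    by apply: derive_val; apply: dF; exact: ltW.
apply: (@integrableS _ _ _ mu `[0%R, +oo[%classic D) => //.
  by move=> x /=; rewrite !in_itv /= !andbT => /ltW.
apply/integrableP; split.
  apply/measurable_EFinP; apply: subspace_continuous_measurable_fun => //.
suff -> : (\int[mu]_(x in `[0%R, +oo[) `|(EFin \o (fun x => (1 + x) ^- 2)) x| =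
  \int[mu]_(x in `[0%R, +oo[) ((1 + x) ^- 2)%:E)%E by rewrite FTC ltry.
apply: eq_integral => x; rewrite inE /= in_itv /= andbT => x0.
by rewrite ger0_norm // invr_ge0 exprn_ge0 // ltW // pos.
Qed.

End baskakov_integrals.

Section vcoef.
Context {R : realType}.
Implicit Types (x t : R) (n k j m : nat) (u f g F h : R -> R).
Local Notation mu := (@lebesgue_measure R).
Local Notation D := (`]0, +oo[%classic : set R).
Local Notation integrable0y u := (mu.-integrable D (EFin \o u)).

Lemma continuousM_halfline u h : (forall x, 0 < x -> {for x, continuous u}) ->
  (forall x, 0 < x -> {for x, continuous h}) ->
  forall x, 0 < x -> {for x, continuous (fun x => u x * h x)}.
Proof. by move=> uc hc x x0; apply: cvgM; [exact: uc|exact: hc]. Qed.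

Lemma integrable_baskakovM m j h (B : R) : (2 <= m)%N ->
  (forall x, 0 < x -> {for x, continuous h}) -> (forall x, 0 < x -> `|h x| <= B) ->
  integrable0y (fun t => baskakov m j t * h t).
Proof.
move=> m2 hc hB; have [C C0 HC] := @baskakov_bound R m j.
have B0 : 0 <= B by apply: le_trans (hB 1 ltr01).
apply: (@le_integrable_halfline R _ (fun t => (C * B) * (1 + t) ^- 2)).
- by apply: continuousM_halfline => // x; exact: continuous_baskakov.
- move=> x x0; have x1 : 0 < 1 + x by rewrite addr_gt0.
  rewrite normrM (ger0_norm (baskakov_ge0 _ _ (ltW x0))) [leRHS]mulrAC.
  apply: ler_pM; [by apply: baskakov_ge0; exact: ltW|exact: normr_ge0| |exact: hB].
  apply: le_trans (HC x x0) _; rewrite ler_wpM2l //.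
  by rewrite lef_pV2 ?posrE ?exprn_gt0 // ler_weXn2l // lerDl ltW.
- exact: integrable_halflineZ integrable_oneDX2V.
Qed.

Lemma integrable_baskakov m j : (2 <= m)%N -> integrable0y (baskakov m j).
Proof.
move=> m2; have := @integrable_baskakovM m j (cst 1) 1 m2.
have -> : (fun t => baskakov m j t * cst 1 t) = baskakov m j.
  by apply/funext => t; rewrite mulr1.
by apply=> [x _|x _]; [exact: cvg_cst|rewrite normr1].
Qed.

Lemma derive_baskakov_difference n j x : (0 < n)%N -> 0 < x ->
  (j.+1%:R - n%:R * x) * baskakov n j.+1 x / psi x =
  n%:R * (baskakov n.+1 j x - baskakov n.+1 j.+1 x).
Proof.
move=> n0 x0; have x1 : 0 < 1 + x by rewrite addr_gt0.
have n0' : 0 < n%:R :> R by rewrite ltr0n.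
have E1 : baskakov n.+1 j x = j.+1%:R * baskakov n j.+1 x / (n%:R * x).
  by rewrite baskakovS //; field; rewrite !gt_eqF.
have E2 : baskakov n.+1 j.+1 x = (n + j.+1)%:R * baskakov n j.+1 x / (n%:R * (1 + x)).
  by rewrite -baskakovSn ?(ltW x0) //; field; rewrite !gt_eqF.
by rewrite E1 E2 /psi natrD; field; rewrite !gt_eqF.
Qed.

Lemma cvg_at0_baskakov0 n : baskakov n 0 x @[x --> 0^'+] --> (1 : R).
Proof.
have -> : baskakov n 0 = (fun x : R => (1 + x) ^- n).
  by apply/funext => x; rewrite /baskakov bin0 expr0 addn0 !mul1r.
apply: cvg_within_filter.
have H : (1 + x) ^- n @[x --> (0 : R)] --> (1 + 0 : R) ^- n.
  apply: cvgV; first by rewrite addr0 expr1n oner_neq0.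
  by apply: (@continuous_comp _ _ _ (fun y : R => 1 + y) (fun y => y ^+ n));
    [apply: cvgD => //; exact: cvg_cst|exact: exprn_continuous].
by move: H; rewrite addr0 expr1n invr1; exact.
Qed.

(** The integral does not depend on [j], because the derivative of
[baskakov m.+1 j.+1] is a multiple of the difference of two consecutive integrands
and its primitive vanishes at both ends. *)
Lemma Rintegral_baskakov m j :
  \int[mu]_(t in D) baskakov m.+2 j t = m.+1%:R^-1.
Proof.
have m0 : m.+1%:R != 0 :> R by rewrite pnatr_eq0.
elim: j => [|j IH].
  pose F (x : R) : R := - m.+1%:R^-1 * baskakov m.+1 0 x.
  transitivity (0 - - m.+1%:R^-1 : R); last by rewrite opprK add0r.
  refine (@Rintegral_halfline_eq R (baskakov m.+2 0) F (- m.+1%:R^-1) 0 _ _ _ _ _).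
  - by move=> x; exact: continuous_baskakov.
  - move=> x x0; have x1 : 0 < 1 + x by rewrite addr_gt0.
    have := is_deriveZ (- m.+1%:R^-1) (is_derive_baskakov m.+1 0 x0).
    move=> d; apply: (is_derive_eq d); rewrite /GRing.scale /= /psi.
    have := baskakovSn 0 (ltn0Sn m) (ltW x0); rewrite addn0 => E.
    have -> : baskakov m.+2 0 x = m.+1%:R * baskakov m.+1 0 x / (m.+1%:R * (1 + x)).
      by rewrite -E; field; rewrite nat1r m0 gt_eqF.
    by field; rewrite nat1r m0 !gt_eqF.
  - exact: integrable_baskakov.
  - have := cvgM (cvg_cst (- m.+1%:R^-1 : R)) (cvg_at0_baskakov0 m.+1).
    by rewrite mulr1; exact.
  - have := cvgM (cvg_cst (- m.+1%:R^-1 : R)) (cvg_pinfty_baskakov 0 (ltn0Sn m)).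
    by rewrite mulr0; exact.
rewrite -IH; apply/eqP; rewrite eq_sym -subr_eq0 -RintegralB //; [|exact: integrable_baskakov..].
apply/eqP; transitivity (0 - 0 : R); last by rewrite subr0.
have [V0 V1] := vanishing_baskakovS j (ltn0Sn m) (R := R).
refine (@Rintegral_halfline_eq R (fun x => baskakov m.+2 j x - baskakov m.+2 j.+1 x)
  (fun x => m.+1%:R^-1 * baskakov m.+1 j.+1 x) 0 0 _ _ _ _ _).
- by move=> x x0; apply: cvgB; exact: continuous_baskakov.
- move=> x x0; have := is_deriveZ (m.+1%:R^-1) (is_derive_baskakov m.+1 j.+1 x0).
  move=> d; apply: (is_derive_eq d); rewrite derive_baskakov_difference //.
  by rewrite /GRing.scale /= mulKf.
- exact: (integrableB _ (integrable_baskakov _ _) (integrable_baskakov _ _)).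
- exact: (vanishingZ m.+1%:R^-1 (vanishing_baskakovS j (ltn0Sn m))).1.
- exact: (vanishingZ m.+1%:R^-1 (vanishing_baskakovS j (ltn0Sn m))).2.
Qed.

End vcoef.

(** * The coefficient functionals *)

Section vcoef.
Context {R : realType}.
Implicit Types (x t B l : R) (n k j m : nat) (u f g F h : R -> R).
Local Notation mu := (@lebesgue_measure R).
Local Notation D := (`]0, +oo[%classic : set R).
Local Notation integrable0y u := (mu.-integrable D (EFin \o u)).

(** The functions whose coefficients are defined and bounded by [B]; [l] is the
coefficient of index 0. *)
Definition tame h B l := [/\ forall x, 0 < x -> {for x, continuous h},
  forall x, 0 < x -> `|h x| <= B & h x @[x --> 0^'+] --> l].

Lemma tame_ge0 h B l : tame h B l -> 0 <= B.
Proof. by move=> [_ hB _]; apply: le_trans (hB 1 ltr01). Qed.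

Lemma tame_limit_le h B l : tame h B l -> `|l| <= B.
Proof.
move=> [_ hB hl]; apply: (ler_cvg_to (cvg_norm hl) (cvg_cst B)).
by near=> x; apply: hB; near: x; exact: nbhs_right_gt.
Unshelve. all: by end_near. Qed.

Lemma tameB f g Bf Bg lf lg : tame f Bf lf -> tame g Bg lg ->
  tame (f \- g) (Bf + Bg) (lf - lg).
Proof.
move=> [fc fB fl] [gc gB gl]; split.
- by move=> x x0; apply: cvgB; [exact: fc|exact: gc].
- move=> x x0; apply: le_trans (ler_normB _ _) _; rewrite lerD //.
    exact: fB.
  exact: gB.
- exact: cvgB.
Qed.

Lemma vcoef0 n h B l : tame h B l -> vcoef n 0 h = l.
Proof. by move=> [_ _ hl]; exact: cvg_lim hl. Qed.

Lemma vcoef_le n k h B l : tame h B l -> `|vcoef n k h| <= B.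
Proof.
move=> hT; case: k => [|k]; first by rewrite (vcoef0 _ hT) (tame_limit_le hT).
have [hc hB _] := hT.
have Pi : integrable0y (fun t => baskakov n.+2 k t * h t) by exact: integrable_baskakovM hB.
rewrite /vcoef normrM ger0_norm // -ler_pdivlMl //.
apply: le_trans (le_normr_Rintegral _ Pi) _ => //.
rewrite -(@Rintegral_baskakov R n k) mulrC -RintegralZl //; last exact: integrable_baskakov.
apply: le_Rintegral => //.
- have := integrable_norm Pi; exact.
- exact: integrable_halflineZ (integrable_baskakov _ _).
- move=> x /=; rewrite in_itv /= andbT => x0.
  have P0 := baskakov_ge0 n.+2 k (ltW x0).
  rewrite normrM (ger0_norm P0) [leRHS]mulrC; apply: ler_wpM2l => //; exact: hB.
Qed.

Lemma vcoefB n k f g Bf Bg lf lg : tame f Bf lf -> tame g Bg lg ->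
  vcoef n k (f \- g) = vcoef n k f - vcoef n k g.
Proof.
move=> fT gT; case: k => [|k].
  by rewrite (vcoef0 _ (tameB fT gT)) (vcoef0 _ fT) (vcoef0 _ gT).
have [fc fB _] := fT; have [gc gB _] := gT.
rewrite /vcoef -mulrBr -RintegralB //.
- by congr (_ * _); apply: eq_Rintegral => x _; rewrite /= mulrBr.
- exact: integrable_baskakovM fB.
- exact: integrable_baskakovM gB.
Qed.

(** The kernels [baskakov n.+2 k] satisfy the recursion [baskakov_up] in [n]. For
[k = 0] both sides reduce to the limit of [h] at 0. *)
Lemma vcoef_up n k h B l : tame h B l ->
  n.+1%:R * vcoef n.+1 k h =
  (n.+1 + k)%:R * vcoef n k h - k%:R * vcoef n k.+1 h.
Proof.
move=> hT; case: k => [|k].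
  by rewrite !(vcoef0 _ hT) addn0 mul0r subr0.
have [hc hB _] := hT.
have int k' m : (2 <= m)%N -> integrable0y (fun t => baskakov m k' t * h t).
  by move=> m2; exact: integrable_baskakovM hB.
rewrite /vcoef [(n.+1 + k.+1)%:R * _]mulrCA [k.+1%:R * _]mulrCA -mulrBr.
congr (_ * _).
rewrite -!RintegralZl //; try exact: int.
rewrite -RintegralB //; try by apply: integrable_halflineZ; exact: int.
apply: eq_Rintegral => x; rewrite inE /= in_itv /= andbT => x0.
have E := baskakov_up k (ltn0Sn n.+1) (ltW x0).
transitivity ((n.+2%:R * baskakov n.+3 k x) * h x); first by ring.
by rewrite E addSnnS; ring.
Qed.

(** The derivative of [baskakov n j.+1] on the half-line, by
[derive_baskakov_difference]. *)
Definition dbask n j x : R := n%:R * (baskakov n.+1 j x - baskakov n.+1 j.+1 x).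

(** The second derivative of [baskakov n j.+1]. For [j = 0] the term of index [-1] is
absent. *)
Definition d2bask n j x : R := (n * n.+1)%:R *
  ((if j is j'.+1 then baskakov n.+2 j' x else 0) - 2 * baskakov n.+2 j x
   + baskakov n.+2 j.+1 x).

Lemma is_derive_dbask n j x : (0 < n)%N -> 0 < x ->
  is_derive x 1 (baskakov n j.+1) (dbask n j x).
Proof.
move=> n0 x0; apply: (is_derive_eq (is_derive_baskakov n j.+1 x0)).
exact: derive_baskakov_difference.
Qed.

Lemma is_derive_d2bask n j x : (0 < n)%N -> 0 < x ->
  is_derive x 1 (dbask n j) (d2bask n j x).
Proof.
move=> n0 x0.
have nearE : \forall y \near x, derive1 (baskakov n j.+1) y = dbask n j y.
  apply: filterS (near_pos x0) => y y0; rewrite derive1_baskakov //.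
  exact: derive_baskakov_difference.
apply: near_eq_is_derive nearE _.
apply: (is_derive_eq (is_derive_derive1_baskakov j.+1 n0 x0)).
have p0 : psi x != 0 by rewrite gt_eqF // psi_gt0.
rewrite /d2bask /= !weightS ?(ltW x0) //; case: j => [|j].
  by rewrite /weight mul0n mul0r; field.
by rewrite weightS ?(ltW x0) //; field.
Qed.

Lemma continuous_dbask n j x : (0 < n)%N -> 0 < x -> {for x, continuous (dbask n j)}.
Proof. by move=> n0 x0; exact: is_derive_continuous (is_derive_d2bask j n0 x0). Qed.

Lemma continuous_d2bask n j x : (0 < n)%N -> 0 < x -> {for x, continuous (d2bask n j)}.
Proof.
move=> n0 x0; apply: cvgM; first exact: cvg_cst.
apply: cvgD; last exact: continuous_baskakov.
apply: cvgB; first by case: j => [|j]; [exact: cvg_cst|exact: continuous_baskakov].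
by apply: cvgM; [exact: cvg_cst|exact: continuous_baskakov].
Qed.

Lemma cvg_pinfty_dbask n j : dbask n j x @[x --> +oo] --> (0 : R).
Proof.
have := cvgM (cvg_cst (n%:R : R)) (cvgB (cvg_pinfty_baskakov j (ltn0Sn n))
  (cvg_pinfty_baskakov j.+1 (ltn0Sn n))).
by rewrite subr0 mulr0; exact.
Qed.

Lemma cvg_at0_dbask n j : dbask n j x @[x --> 0^'+] --> ((j == 0)%:R * n%:R : R).
Proof.
have B1 : baskakov n.+1 j x @[x --> 0^'+] --> ((j == 0)%:R : R).
  by case: j => [|j]; [exact: cvg_at0_baskakov0|exact: (vanishing_baskakovS j (ltn0Sn n)).1].
have := cvgM (cvg_cst (n%:R : R)) (cvgB B1 (vanishing_baskakovS j (ltn0Sn n)).1).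
by rewrite subr0 mulrC; exact.
Qed.

(** For [j = 0] the missing basis function is compensated by the limit at 0, which is
[vcoef n 0 h]; hence the correction by [l]. *)
Lemma Rintegral_d2bask n j h B l : (0 < n)%N -> tame h B l ->
  integrable0y (fun t => d2bask n j t * h t) /\
  \int[mu]_(t in D) (d2bask n j t * h t) =
  n%:R * (vcoef n j h - 2 * vcoef n j.+1 h + vcoef n j.+2 h) - (j == 0)%:R * n%:R * l.
Proof.
move=> n0 hT; have [hc hB _] := hT.
have int k : integrable0y (fun t => baskakov n.+2 k t * h t).
  exact: integrable_baskakovM hB.
have intI (c : R) k : integrable0y (fun t => c * (baskakov n.+2 k t * h t)).
  exact: integrable_halflineZ.
pose u1 x := (if j is j'.+1 then baskakov n.+2 j' x else 0) * h x.
have i1 : integrable0y u1.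
  rewrite /u1; case: j {u1} => [|j]; last exact: int.
  apply: eq_integrable (intI 0 0%N) => // x _ /=.
  by rewrite !mul0r.
have I1 : n.+1%:R * \int[mu]_(t in D) u1 t = vcoef n j h - (j == 0)%:R * l.
  rewrite /u1; case: j {u1 i1} => [|j]; last by rewrite mul0r subr0.
  rewrite (vcoef0 _ hT) mul1r subrr (_ : Rintegral _ _ _ = 0) ?mulr0 //.
  under eq_Rintegral do rewrite mul0r.
  by rewrite /Rintegral integral0.
have uE : (fun t => d2bask n j t * h t) = (fun t => (n * n.+1)%:R *
   (u1 t - 2 * (baskakov n.+2 j t * h t) + baskakov n.+2 j.+1 t * h t)).
  apply/funext => t; rewrite /d2bask /u1 -mulrA; congr (_ * _).
  by case: j {u1 i1 I1} => [|j]; ring.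
have i2 : integrable0y (fun t => u1 t - 2 * (baskakov n.+2 j t * h t)).
  exact: (integrableB _ i1 (intI 2 j)).
have i3 : integrable0y (fun t => u1 t - 2 * (baskakov n.+2 j t * h t) +
    baskakov n.+2 j.+1 t * h t).
  exact: (integrableD _ i2 (int j.+1)).
rewrite uE; split; first exact: integrable_halflineZ.
rewrite RintegralZl // RintegralD // RintegralB // RintegralZl //.
rewrite natrM -mulrA mulrDr mulrBr I1 /vcoef; ring.
Qed.

End vcoef.

(** * Second differences of the coefficients *)

Section second_difference.
Context {R : realType}.
Implicit Types (x t B l : R) (n k j m : nat) (u f g F h : R -> R).
Local Notation mu := (@lebesgue_measure R).
Local Notation D := (`]0, +oo[%classic : set R).
Local Notation integrable0y u := (mu.-integrable D (EFin \o u)).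

(** [- dphi x = ln (1 + 1 / x)], and [1 + 1 / x <= (1 + 1 / sqrt x)^2]. The bound is
integrable at 0 and makes [x * dphi x] vanish there. *)
Lemma dphi_bound x : 0 < x -> `|dphi x| <= 2 / Num.sqrt x.
Proof.
move=> x0; set s := Num.sqrt x; have s0 : 0 < s by rewrite sqrtr_gt0.
have x1 : 0 < 1 + x by rewrite addr_gt0.
have y0 : 0 < 1 + s^-1 by rewrite addr_gt0 // invr_gt0.
have -> : dphi x = - ln (1 + x^-1).
  rewrite /dphi -ln_div ?posrE // -lnV ?posrE; last by rewrite addr_gt0 // invr_gt0.
  by congr ln; field; rewrite addrC !gt_eqF.
rewrite normrN ger0_norm; last by rewrite ln_ge0 // lerDl invr_ge0 ltW.
apply: (@le_trans _ _ (ln ((1 + s^-1) ^+ 2))).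
  rewrite ler_ln ?posrE ?exprn_gt0 ?addr_gt0 ?invr_gt0 //.
  have xE : x = s ^+ 2 by rewrite sqr_sqrtr // ltW.
  have r0 : 0 < s^-1 by rewrite invr_gt0.
  by rewrite xE -exprVn; nra.
rewrite lnXn ?posrE // -(mulr_natl (ln _)) ler_wpM2l //.
apply: le_trans (le_ln1Dx _) _ => //.
by apply: (lt_trans (y := 0)); rewrite ?ltrN10 ?invr_gt0.
Qed.

Lemma vanishing_norm F : vanishing F -> vanishing (fun x => `|F x|).
Proof.
by move=> [F0 F1]; split; [have := cvg_norm F0|have := cvg_norm F1]; rewrite normr0; exact.
Qed.

Lemma le_cvg_pinfty0 F f : (forall x, 0 < x -> `|F x| <= f x) ->
  f x @[x --> +oo] --> 0 -> F x @[x --> +oo] --> 0.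
Proof.
move=> Ff f1; apply/norm_cvg0P; apply: (squeeze_cvgr _ (cvg_cst 0) f1).
by near=> x; rewrite normr_ge0 Ff //; near: x; exact: nbhs_pinfty_gt.
Unshelve. all: by end_near. Qed.

Lemma vanishing_baskakov_dphi n j : (0 < n)%N ->
  vanishing (fun x => baskakov n j.+1 x * dphi x).
Proof.
move=> n0; have [C C0 H] := @baskakovS_bound R n j n0.
apply: le_vanishing (vanishingZ (C * 2) vanishing_sqrt) => x x0.
have x1 : 0 < 1 + x by rewrite addr_gt0.
have s0 : 0 < Num.sqrt x by rewrite sqrtr_gt0.
rewrite normrM (ger0_norm (baskakov_ge0 _ _ (ltW x0))).
apply: (@le_trans _ _ (C * (x / (1 + x) ^+ 2) * (2 / Num.sqrt x))).
  apply: ler_pM; [by apply: baskakov_ge0; exact: ltW|exact: normr_ge0|exact: H|exact: dphi_bound].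
rewrite -{1}(sqr_sqrtr (ltW x0)).
have -> : C * (Num.sqrt x ^+ 2 / (1 + x) ^+ 2) * (2 / Num.sqrt x) =
   C * 2 * (Num.sqrt x / (1 + x)) * (1 + x)^-1 by field; rewrite !gt_eqF.
rewrite ler_piMr //; last by rewrite invf_le1 // lerDl ltW.
by rewrite !mulr_ge0 ?invr_ge0 ?sqrtr_ge0 ?(ltW x1).
Qed.

Lemma weight_psi n j x : (0 < n)%N -> 0 < x ->
  baskakov n j.+1 x / psi x =
  (n * n.+1)%:R / (j.+1 * (n + j.+1))%:R * baskakov n.+2 j x.
Proof.
move=> n0 x0; have := weightS j n0 (ltW x0); rewrite /weight => E.
have p0 : psi x != 0 by rewrite gt_eqF // psi_gt0.
have k0 : (j.+1 * (n + j.+1))%:R != 0 :> R by rewrite pnatr_eq0 muln_eq0 addnS.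
move: E k0; set a : R := (j.+1 * _)%:R; set b : R := (n * _)%:R => E a0.
clearbody a b.
have -> : baskakov n j.+1 x = b * psi x * baskakov n.+2 j x / a by rewrite -E mulrC mulKf.
by field; rewrite a0 p0.
Qed.

(** Two integrations by parts move the two derivatives in [G = psi * g''] onto
the basis function, whose second derivative is a second difference of basis
functions. For [j = 0] the boundary term at 0 supplies the term in [vcoef n 0 g]. *)
Lemma vcoef_second_difference n j g (g' G : R -> R) B l (B1 A1 A2 : R) : (0 < n)%N ->
  tame g B l -> (forall x, 0 < x -> is_derive x 1 g (g' x)) ->
  (forall x, 0 < x -> is_derive x 1 g' (G x / psi x)) ->
  (forall x, 0 < x -> {for x, continuous G}) ->
  (forall x, 0 < x -> `|G x| <= B1) ->
  (forall x, 0 < x -> `|g' x| <= A1 + A2 * `|dphi x|) ->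
  (j.+1 * (n + j.+1))%:R * (vcoef n j g - 2 * vcoef n j.+1 g + vcoef n j.+2 g) =
  vcoef n j.+1 G.
Proof.
move=> n0 gT dg dg' Gc GB g'b; have [gc gB gl] := gT.
pose c : R := (n * n.+1)%:R / (j.+1 * (n + j.+1))%:R.
have k0 : (j.+1 * (n + j.+1))%:R != 0 :> R by rewrite pnatr_eq0 muln_eq0 addnS.
have nn0 : n%:R != 0 :> R by rewrite pnatr_eq0 -lt0n.
pose u x := d2bask n j x * g x - c * (baskakov n.+2 j x * G x).
(* The primitive of [P'' g - P g''], where [P] is [baskakov n j.+1]. *)
pose F x := dbask n j x * g x - baskakov n j.+1 x * g' x.
have [di dE] := Rintegral_d2bask j n0 gT.
have Gi : integrable0y (fun x => c * (baskakov n.+2 j x * G x)).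
  by apply: integrable_halflineZ; exact: integrable_baskakovM GB.
have ui : integrable0y u by exact: (integrableB _ di Gi).
have uc x : 0 < x -> {for x, continuous u}.
  move=> x0; apply: cvgB; first by apply: cvgM; [exact: continuous_d2bask|exact: gc].
  apply: cvgM; first exact: cvg_cst.
  by apply: cvgM; [exact: continuous_baskakov|exact: Gc].
have dF x : 0 < x -> is_derive x 1 F (u x).
  move=> x0.
  have := is_deriveB (is_deriveM (is_derive_d2bask j n0 x0) (dg x x0))
    (is_deriveM (is_derive_dbask j n0 x0) (dg' x x0)).
  move=> d; apply: (is_derive_eq d); rewrite /GRing.scale /= /u.
  have := weight_psi j n0 x0; rewrite -/c => E.
  transitivity (d2bask n j x * g x - (baskakov n j.+1 x / psi x) * G x); last by rewrite E; ring.
  by ring.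
have bg' : vanishing (fun x => baskakov n j.+1 x * g' x).
  have V1 := vanishingZ A1 (@vanishing_baskakovS R n j n0).
  have V2 : vanishing (fun x => A2 * (baskakov n j.+1 x * `|dphi x|)).
    apply: vanishingZ; apply: le_vanishing (vanishing_norm (vanishing_baskakov_dphi j n0)) => x _.
    by rewrite !normrM normr_id.
  apply: le_vanishing (vanishingD V1 V2) => x x0.
  rewrite normrM (ger0_norm (baskakov_ge0 _ _ (ltW x0))).
  apply: (@le_trans _ _ (baskakov n j.+1 x * (A1 + A2 * `|dphi x|))); last by rewrite le_eqVlt; apply/orP; left; apply/eqP; ring.
  by apply: ler_wpM2l; [by apply: baskakov_ge0; exact: ltW|exact: g'b].
have F0 : F x @[x --> 0^'+] --> (j == 0)%:R * n%:R * l.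
  have := cvgB (cvgM (@cvg_at0_dbask R n j) gl) bg'.1.
  by rewrite subr0; exact.
have Dg1 : dbask n j x * g x @[x --> +oo] --> (0 : R).
  apply: (@le_cvg_pinfty0 _ (fun x => B * `|dbask n j x|)).
    by move=> x x0; rewrite normrM mulrC ler_wpM2r // gB.
  have := cvgM (cvg_cst B) (cvg_norm (@cvg_pinfty_dbask R n j)).
  by rewrite normr0 mulr0; exact.
have F1 : F x @[x --> +oo] --> 0.
  have := cvgB Dg1 bg'.2.
  by rewrite subr0; exact.
have := Rintegral_halfline_eq uc dF ui F0 F1.
rewrite sub0r /u RintegralB // dE RintegralZl //; last exact: integrable_baskakovM GB.
rewrite [vcoef n j.+1 G]/vcoef.
set V := _ + vcoef n j.+2 g; set I := \int[mu]_(t in D) (baskakov n.+2 j t * G t).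
move=> E; have {}E : n%:R * V = c * I by lra.
apply: (mulfI nn0); rewrite mulrCA E /c (natrM _ n n.+1); move: k0; set a := (_ * _)%:R.
by clearbody a; move=> a0; field.
Qed.

(** Only the oscillation of the derivative [G'] enters: one integration by parts
turns the second difference into the integral of [G'] against the derivative of
[baskakov n j.+1]. That derivative is positive up to [t0 = j.+1 / n] and negative
afterwards, and [G' - G' t0] is dominated by [M * (dphi - dphi t0)], which also
changes sign at [t0]. Integrating the dominating function by parts again leaves
[M] times the integral of [baskakov n j.+1 / psi], which is explicit. *)
Lemma norm_vcoef_second_difference n j (G G' : R -> R) B (M : R) : (0 < n)%N -> 0 <= M ->
  tame G B 0 -> (forall x, 0 < x -> is_derive x 1 G (G' x)) ->
  (forall x, 0 < x -> {for x, continuous G'}) ->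
  (forall x t, 0 < x -> x <= t -> `|G' t - G' x| <= M * (dphi t - dphi x)) ->
  `|(j.+1 * (n + j.+1))%:R * (vcoef n j G - 2 * vcoef n j.+1 G + vcoef n j.+2 G)| <= M.
Proof.
move=> n0 M0 GT dG G'c HM; have [Gc GB Gl] := GT.
pose c : R := (n * n.+1)%:R / (j.+1 * (n + j.+1))%:R.
have k0 : (j.+1 * (n + j.+1))%:R != 0 :> R by rewrite pnatr_eq0 muln_eq0 addnS.
have kp : 0 < (j.+1 * (n + j.+1))%:R :> R by rewrite ltr0n muln_gt0 addnS.
have np : 0 < n%:R :> R by rewrite ltr0n.
(* The maximum of [baskakov n j.+1]. *)
pose t0 : R := j.+1%:R / n%:R.
have t00 : 0 < t0 by rewrite divr_gt0.
have [di dE] := Rintegral_d2bask j n0 GT.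
have sgn x : 0 < x -> `|dbask n j x * (G' x - G' t0)| <= - M * (dbask n j x * (dphi x - dphi t0)).
  move=> x0; have p0 := psi_gt0 x0.
  have P0 := baskakov_ge0 n j.+1 (ltW x0).
  have dE' : dbask n j x = (t0 - x) * (n%:R * baskakov n j.+1 x / psi x).
    rewrite -[LHS]derive_baskakov_difference // /t0; field.
    by rewrite !gt_eqF.
  have q0 : 0 <= n%:R * baskakov n j.+1 x / psi x.
    by apply: divr_ge0; [exact: mulr_ge0|exact: ltW].
  have [xt|/ltW tx] := leP x t0.
    have d0 : 0 <= dbask n j x by rewrite dE' mulr_ge0 // subr_ge0.
    rewrite normrM (ger0_norm d0) mulrCA; apply: ler_wpM2l => //.
    by rewrite distrC; have := HM x t0 x0 xt; lra.
  have d0 : dbask n j x <= 0 by rewrite dE' mulr_le0_ge0 // subr_le0.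
  rewrite normrM (ler0_norm d0).
  have -> : - M * (dbask n j x * (dphi x - dphi t0)) =
    - dbask n j x * (M * (dphi x - dphi t0)) by ring.
  by apply: ler_wpM2l; [rewrite oppr_ge0|exact: HM].
(* Both signs of the second difference are treated at once by the factor [s]. *)
have bound (s : R) : `|s| = 1 ->
    s * \int[mu]_(t in D) (d2bask n j t * G t) - M * (c * n.+1%:R^-1) <= 0.
  move=> s1.
  pose u x := s * (d2bask n j x * G x) - M * (c * baskakov n.+2 j x).
  pose F x := s * (dbask n j x * G x - G' t0 * baskakov n j.+1 x) -
     M * (baskakov n j.+1 x * (dphi x - dphi t0)).
  pose f x := s * (d2bask n j x * G x + dbask n j x * G' x - G' t0 * dbask n j x) -
     M * (dbask n j x * (dphi x - dphi t0) + baskakov n j.+1 x / psi x).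
  have cbi : integrable0y (fun x => M * (c * baskakov n.+2 j x)).
    by do 2 apply: integrable_halflineZ; exact: integrable_baskakov.
  have sdi := integrable_halflineZ s di.
  have ui : integrable0y u by exact: (integrableB _ sdi cbi).
  have cc (a : R) x : {for x, continuous (fun _ : R => a)} by exact: cvg_cst.
  have uc x : 0 < x -> {for x, continuous u}.
    move=> x0; apply: cvgB; apply: cvgM; try exact: cc.
      by apply: cvgM; [exact: continuous_d2bask|exact: Gc].
    by apply: cvgM; [exact: cc|exact: continuous_baskakov].
  have dphic x : 0 < x -> {for x, continuous (dphi : R -> R)}.
    by move=> x0; exact: is_derive_continuous (is_derive_dphi x0).
  have fc x : 0 < x -> {for x, continuous f}.
    move=> x0; apply: cvgB; apply: cvgM; try exact: cc.
      apply: cvgB; last by apply: cvgM; [exact: cc|exact: continuous_dbask].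
      apply: cvgD; apply: cvgM; [exact: continuous_d2bask|exact: Gc|exact: continuous_dbask|exact: G'c].
    apply: cvgD; apply: cvgM; [exact: continuous_dbask| |exact: continuous_baskakov|].
      by apply: cvgB; [exact: dphic|exact: cc].
    apply: cvgV; first by rewrite gt_eqF // psi_gt0.
    by rewrite /psi; apply: cvgM => //; apply: cvgD => //; exact: cc.
  have dF x : 0 < x -> is_derive x 1 F (f x).
    move=> x0; have dP := is_derive_dbask j n0 x0.
    have d1 := is_deriveZ s (is_deriveB (is_deriveM (is_derive_d2bask j n0 x0) (dG x x0))
       (is_deriveZ (G' t0) dP)).
    have d2 := is_deriveZ M (is_deriveM dP (is_deriveB (is_derive_dphi x0) (is_derive_cst (dphi t0) x 1))).
    apply: (is_derive_eq (is_deriveB d1 d2)); rewrite /GRing.scale /= /f !fctE /cst; ring.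
  have uf x : 0 < x -> u x <= f x.
    move=> x0; rewrite /u /f weight_psi // -/c -subr_ge0.
    have := sgn x x0; have : - `|dbask n j x * (G' x - G' t0)| <= s * (dbask n j x * (G' x - G' t0)).
      by rewrite lerNl -mulNr; apply: le_trans (ler_norm _) _; rewrite normrM normrN s1 mul1r.
    lra.
  have V := @vanishing_baskakovS R n j n0.
  have VD : vanishing (fun x => M * (baskakov n j.+1 x * (dphi x - dphi t0))).
    apply: vanishingZ.
    have -> : (fun x => baskakov n j.+1 x * (dphi x - dphi t0)) =
      (fun x => baskakov n j.+1 x * dphi x + (- dphi t0) * baskakov n j.+1 x).
      by apply/funext => x; ring.
    by apply: vanishingD; [exact: vanishing_baskakov_dphi|exact: vanishingZ].
  have VG : vanishing (fun x => dbask n j x * G x).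
    split.
      by have := cvgM (@cvg_at0_dbask R n j) Gl; rewrite mulr0; exact.
    apply: (@le_cvg_pinfty0 _ (fun x => B * `|dbask n j x|)).
      by move=> x x0; rewrite normrM mulrC ler_wpM2r // GB.
    have := cvgM (cvg_cst B) (cvg_norm (@cvg_pinfty_dbask R n j)).
    by rewrite normr0 mulr0; exact.
  have VF : vanishing F.
    have -> : F = (fun x => s * (dbask n j x * G x + (- G' t0) * baskakov n j.+1 x) +
       (-1) * (M * (baskakov n j.+1 x * (dphi x - dphi t0)))).
      by apply/funext => x; rewrite /F; ring.
    apply: vanishingD; last exact: vanishingZ.
    by apply: vanishingZ; apply: vanishingD => //; exact: vanishingZ.
  have := @Rintegral_halfline_le R u F f 0 0 uc fc dF uf ui VF.1 VF.2.
  rewrite subr0 /u RintegralB // RintegralZl // RintegralZl; last 2 first.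
  - by [].
  - by apply: integrable_halflineZ; exact: integrable_baskakov.
  by rewrite RintegralZl // ?Rintegral_baskakov //; exact: integrable_baskakov.
have b1 := bound 1 (normr1 _).
have b2 := bound (-1) (normrN1 _).
move: b1 b2; rewrite dE mulr0 subr0.
set V := _ + vcoef n j.+2 G => b1 b2.
have cn : c * n.+1%:R^-1 = n%:R / (j.+1 * (n + j.+1))%:R.
  by rewrite /c (natrM _ n n.+1); move: k0; set a := (_ * _)%:R; clearbody a; move=> a0; field; rewrite nat1r pnatr_eq0 a0.
rewrite cn in b1 b2.
have nV : `|n%:R * V| <= M * (n%:R / (j.+1 * (n + j.+1))%:R).
  move: b1 b2; set q := M * _; set z := n%:R * V; clearbody q z => b1 b2.
  by rewrite ler_norml; apply/andP; split; lra.
rewrite normrM gtr0_norm // mulrC -ler_pdivlMr //.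
move: nV; rewrite normrM gtr0_norm // mulrCA ler_pM2l //.
Qed.

End second_difference.

(** * Series in the Baskakov basis *)

Section series.
Context {R : realType}.
Implicit Types (x B S W : R) (n k N : nat) (v w : nat -> R).

(** For [p = Ptilde n ^~ x] the second bound is the norm of [Vtilde n] at [x]. *)
Lemma is_cvg_series_bounded (p v : nat -> R) B (C : R) :
  (forall k, `|v k| <= B) -> (forall N, series (fun k => `|p k|) N <= C) ->
  cvgn (series (fun k => v k * p k)) /\
  `|limn (series (fun k => v k * p k))| <= B * C.
Proof.
move=> vB pC; have B0 : 0 <= B by exact: le_trans (vB 0%N).
have pc : cvgn (series (fun k => B * `|p k|)).
  apply: nondecreasing_is_cvgn.
    by apply/nondecreasing_seqP => N; rewrite seriesSr lerDl mulr_ge0.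
  exists (B * C) => _ [N _ <-]; rewrite /series /= -big_distrr /=.
  by apply: ler_wpM2l => //; exact: pC.
have vp k : `|v k * p k| <= B * `|p k| by rewrite normrM ler_wpM2r.
have cv : cvgn (series (fun k => v k * p k)).
  apply: normed_cvg; apply: series_le_cvg pc => [k|k|k]; [exact: normr_ge0|exact: mulr_ge0|exact: vp].
split=> //; apply: (ler_cvg_to (cvg_norm cv) (cvg_cst (B * C))).
apply: nearW => N; apply: le_trans (ler_norm_sum _ _ _) _.
apply: (@le_trans _ _ (B * series (fun k => `|p k|) N)); last first.
  by apply: ler_wpM2l => //; exact: pC.
by rewrite /series /= big_distrr /=; apply: ler_sum => k _.
Qed.

Lemma bsum_bounded n x v B : (0 < n)%N -> 0 <= x -> (forall k, `|v k| <= B) ->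
  exists2 S, bsum n x v S & `|S| <= B.
Proof.
move=> n0 x0 vB.
have pC N : series (fun k => `|baskakov n k x|) N <= 1.
  rewrite (_ : (fun k => _) = (fun k => baskakov n k x)) ?baskakov_partial_le1 //.
  by apply/funext => k; rewrite ger0_norm ?baskakov_ge0.
have [cv lB] := is_cvg_series_bounded vB pC; rewrite mulr1 in lB.
by exists (limn (series (fun k => v k * baskakov n k x))).
Qed.

Lemma bsum_family x B (v : nat -> nat -> R) : 0 <= x ->
  (forall n k, (0 < n)%N -> `|v n k| <= B) ->
  exists S : nat -> R, forall n, (0 < n)%N -> bsum n x (v n) (S n) /\ `|S n| <= B.
Proof.
move=> x0 vB.
have /choice[S HS] : forall n, exists s : R, (0 < n)%N -> bsum n x (v n) s /\ `|s| <= B.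
  case=> [|n]; first by exists 0.
  by have [s ? ?] := bsum_bounded (ltn0Sn n) x0 (fun k => vB n.+1 k (ltn0Sn n)); exists s.
by exists S.
Qed.

Lemma bsum_uniq n x v S W : bsum n x v S -> bsum n x v W -> S = W.
Proof. exact: (cvg_unique _). Qed.

Lemma bsum_norm_le n x v w S W : 0 <= x -> (forall k, `|v k| <= w k) ->
  bsum n x v S -> bsum n x w W -> `|S| <= W.
Proof.
move=> x0 vw vS wW; apply: (ler_cvg_to (cvg_norm vS) wW); apply: nearW => N.
apply: le_trans (ler_norm_sum _ _ _) _; apply: ler_sum => k _.
by rewrite normrM (ger0_norm (baskakov_ge0 _ _ x0)) ler_wpM2r ?baskakov_ge0.
Qed.

(** The image under [Dtilde] of the function with coefficients [v], read on its
coefficients. *)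
Definition wdiff n v k : R := (k * (n + k))%:R * (v k.-1 - 2 * v k + v k.+1).

(** Substituting the recursions in [n] of the coefficients and of the basis, the
coefficient of [baskakov n k x] becomes [v k - wdiff n v k / (n * (n + 1))], up to a
boundary term which tends to 0. *)
Lemma bsum_up n x v v' B S S' W : (0 < n)%N -> 0 <= x -> (forall k, `|v' k| <= B) ->
  (forall k, n.+1%:R * v' k = (n.+1 + k)%:R * v k - k%:R * v k.+1) ->
  bsum n x v S -> bsum n.+1 x v' S' -> bsum n x (wdiff n v) W ->
  S' = S - W / (n * n.+1)%:R.
Proof.
move=> n0 x0 v'B rec vS v'S wW.
have nn0 : n%:R != 0 :> R by rewrite pnatr_eq0 -lt0n.
have n1 : n.+1%:R != 0 :> R by rewrite pnatr_eq0.
have partial N : series (fun k => v' k * baskakov n.+1 k x) N =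
    series (fun k => v k * baskakov n k x) N -
    (n * n.+1)%:R^-1 * series (fun k => wdiff n v k * baskakov n k x) N -
    n%:R^-1 * (v' N.-1 * (N%:R * baskakov n N x)).
  have v'E k : v' k = ((n.+1 + k)%:R * v k - k%:R * v k.+1) / n.+1%:R.
    by rewrite -rec mulrC mulKf.
  elim: N => [|N IH]; first by rewrite /series /= !big_nil; ring.
  rewrite !seriesSr IH /wdiff.
  have -> : baskakov n.+1 N x =
      ((n + N)%:R * baskakov n N x - N.+1%:R * baskakov n N.+1 x) / n%:R.
    by rewrite -baskakov_up // mulrC mulKf.
  case: N {IH} => [|N] /=.
    by rewrite !v'E !addn0 natrM; field; rewrite nn0 nat1r n1.
  rewrite !v'E !natrM !addSn !addnS -![_.+1%:R]natr1 !natrD; field.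
  by rewrite nn0 natr1 n1.
have lim0 : v' N.-1 * (N%:R * baskakov n N x) @[N --> \oo] --> (0 : R).
  apply/norm_cvg0P.
  have H : B * `|N%:R * baskakov n N x| @[N --> \oo] --> (0 : R).
    have := cvgM (cvg_cst B) (cvg_norm (cvg_baskakovM0 n0 x0)).
    by rewrite normr0 mulr0; exact.
  apply: (squeeze_cvgr _ (cvg_cst 0) H).
  by apply: nearW => N; rewrite normr_ge0 normrM ler_wpM2r.
have := cvgB (cvgB vS (cvgM (cvg_cst ((n * n.+1)%:R^-1 : R)) wW)) (cvgM (cvg_cst (n%:R^-1 : R)) lim0).
rewrite mulr0 subr0 [_^-1 * W]mulrC => H; apply: (bsum_uniq v'S); rewrite /bsum.
rewrite (_ : series _ = (fun N => series (fun k => v k * baskakov n k x) N -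
    (n * n.+1)%:R^-1 * series (fun k => wdiff n v k * baskakov n k x) N -
    n%:R^-1 * (v' N.-1 * (N%:R * baskakov n N x)))); first exact: H.
by apply/funext => N; rewrite partial.
Qed.

(** Summation by parts: [Dtilde] moves from the basis to the coefficients. *)
Lemma cvg_series_Dtilde n x v B W : (0 < n)%N -> 0 < x -> (forall k, `|v k| <= B) ->
  bsum n x (wdiff n v) W ->
  series (fun k => v k * Dtilde (baskakov n k) x) @ \oo --> W.
Proof.
move=> n0 x0 vB wW.
pose e k := weight n k x.
have partial N : series (fun k => v k * Dtilde (baskakov n k) x) N =
    series (fun k => wdiff n v k * baskakov n k x) N + (v N.-1 * e N - v N * e N.-1).
  elim: N => [|N IH]; first by rewrite /series /= !big_nil; ring.
  by rewrite !seriesSr IH Dtilde_baskakov // /wdiff /e /weight /=; ring.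
have e0 : e N @[N --> \oo] --> (0 : R).
  rewrite -(cvg_shiftS e) /=.
  have -> : (fun k => e k.+1) = (fun k => (n * n.+1)%:R * psi x * baskakov n.+2 k x).
    by apply/funext => k; rewrite /e weightS // ltW.
  have := cvgM (cvg_cst ((n * n.+1)%:R * psi x)) (cvg_baskakov0 (ltn0Sn n.+1) (ltW x0)).
  by rewrite mulr0; exact.
have e0' : e N.-1 @[N --> \oo] --> (0 : R).
  by rewrite -(cvg_shiftS (fun N => e N.-1)) /=; exact: e0.
have bnd (s t : nat -> R) : (forall k, `|s k| <= B) -> t N @[N --> \oo] --> (0 : R) ->
    s N * t N @[N --> \oo] --> (0 : R).
  move=> sB t0; apply/norm_cvg0P.
  have H : B * `|t N| @[N --> \oo] --> (0 : R).
    by have := cvgM (cvg_cst B) (cvg_norm t0); rewrite normr0 mulr0; exact.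
  apply: (squeeze_cvgr _ (cvg_cst 0) H).
  by apply: nearW => N; rewrite normr_ge0 normrM ler_wpM2r.
have := cvgD wW (cvgB (bnd (fun N => v N.-1) e (fun k => vB _) e0) (bnd v _ vB e0')).
rewrite subr0 addr0 => H.
rewrite (_ : series _ = (fun N => series (fun k => wdiff n v k * baskakov n k x) N +
  (v N.-1 * e N - v N * e N.-1))); first exact: H.
by apply/funext => N; rewrite partial.
Qed.

(** [S], [T], [U] stand for the operators applied to [g], [Dtilde g] and
[Dtilde (Dtilde g)]. The sum telescopes twice. *)
Lemma telescoping_bound (S T U : nat -> R) (M s : R) n : (0 < n)%N -> 0 <= M ->
  (forall k, (n <= k)%N -> `|U k| <= M) ->
  (forall k, (n <= k)%N -> T k.+1 = T k - U k / (k * k.+1)%:R) ->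
  (forall k, (n <= k)%N -> S k.+1 = S k - T k / (k * k.+1)%:R) ->
  S k @[k --> \oo] --> s ->
  `|S n - T n / n%:R - s| <= M / n%:R ^+ 2.
Proof.
move=> n0 M0 UM TE SE Ss.
have nn0 : 0 < n%:R :> R by rewrite ltr0n.
have split k : (0 < k)%N -> (k * k.+1)%:R^-1 = k%:R^-1 - k.+1%:R^-1 :> R.
  move=> k0; have kk : k%:R != 0 :> R by rewrite pnatr_eq0 -lt0n.
  have k1 : k.+1%:R != 0 :> R by rewrite pnatr_eq0.
  by rewrite natrM; move: k1; rewrite -natr1 => k1; field; rewrite kk k1.
have kpos i : 0 < (n + i)%:R :> R by rewrite ltr0n addn_gt0 n0.
have kinv i : 0 <= (n + i)%:R^-1 - (n + i).+1%:R^-1 :> R.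
  by rewrite subr_ge0 lef_pV2 ?posrE ?ltr0n ?addn_gt0 ?n0 // ler_nat.
have TB i : `|T (n + i)%N - T n| <= M * (n%:R^-1 - (n + i)%:R^-1).
  elim: i => [|i IH]; first by rewrite addn0 !subrr normr0 mulr0.
  rewrite addnS TE ?leq_addr // split ?addn_gt0 ?n0 // addrAC.
  apply: le_trans (ler_normB _ _) _.
  have -> : M * (n%:R^-1 - (n + i).+1%:R^-1) = M * (n%:R^-1 - (n + i)%:R^-1) +
    M * ((n + i)%:R^-1 - (n + i).+1%:R^-1) by ring.
  apply: lerD IH _; rewrite normrM (ger0_norm (kinv i)); apply: ler_wpM2r => //.
  by apply: UM; rewrite leq_addr.
have TB' i : `|T (n + i)%N - T n| <= M / n%:R.
  apply: le_trans (TB i) _; apply: ler_wpM2l => //.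
  by rewrite gerBl invr_ge0 ltW.
have SB i : `|S n - S (n + i)%N - T n * (n%:R^-1 - (n + i)%:R^-1)| <=
    M / n%:R * (n%:R^-1 - (n + i)%:R^-1).
  elim: i => [|i IH]; first by rewrite addn0 !subrr !mulr0 subrr normr0.
  rewrite addnS SE ?leq_addr // split ?addn_gt0 ?n0 //.
  set a := n%:R^-1 in IH *; set b := (n + i)%:R^-1 in IH *; set c := (n + i).+1%:R^-1.
  have -> : S n - (S (n + i)%N - T (n + i)%N * (b - c)) - T n * (a - c) =
    (S n - S (n + i)%N - T n * (a - b)) + (T (n + i)%N - T n) * (b - c) by ring.
  apply: le_trans (ler_normD _ _) _.
  have -> : M * a * (a - c) = M * a * (a - b) + M * a * (b - c) by ring.
  apply: lerD IH _; rewrite normrM (ger0_norm (kinv i)).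
  by apply: ler_wpM2r; [exact: kinv|exact: TB'].
have Sn : S (n + i)%N @[i --> \oo] --> s.
  have := Ss; rewrite -(cvg_shiftn n) => H.
  by under eq_fun do rewrite addnC.
have inv0 : (n + i)%:R^-1 @[i --> \oo] --> (0 : R).
  have := @cvg_harmonic R; rewrite -(cvg_shiftn n.-1).
  have -> : (fun i => harmonic (i + n.-1)%N) = (fun i => (n + i)%:R^-1) :> (nat -> R).
    by apply/funext => i; rewrite /harmonic /= -addnS prednK // addnC.
  exact.
have dinv : n%:R^-1 - (n + i)%:R^-1 @[i --> \oo] --> (n%:R^-1 : R).
  by rewrite -[X in _ --> X]subr0; apply: cvgB => //; exact: cvg_cst.
have C1 : S n - S (n + i)%N - T n * (n%:R^-1 - (n + i)%:R^-1) @[i --> \oo] -->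
    S n - s - T n * n%:R^-1.
  by apply: cvgB; [apply: cvgB => //; exact: cvg_cst|apply: cvgM => //; exact: cvg_cst].
have C2 : M / n%:R * (n%:R^-1 - (n + i)%:R^-1) @[i --> \oo] --> M / n%:R * n%:R^-1.
  by apply: cvgM => //; exact: cvg_cst.
have -> : S n - T n / n%:R - s = S n - s - T n / n%:R by ring.
rewrite expr2 invfM mulrA.
by apply: (ler_cvg_to (cvg_norm C1) C2 (nearW _ SB)).
Qed.

End series.

(** * Pointwise convergence of the operators *)

Section approximation.
Context {R : realType}.
Implicit Types (x y t B l a : R) (n k j m : nat) (g h : R -> R).
Local Notation mu := (@lebesgue_measure R).
Local Notation D := (`]0, +oo[%classic : set R).
Local Notation integrable0y u := (mu.-integrable D (EFin \o u)).

(** The coefficient of index [k] of the function [(t - x)^2] for [n = m.+2]. *)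
Definition sqdev m x k : R :=
  (k * k.+1)%:R / (m.+2 * m.+1)%:R - 2 * x * k%:R / m.+2%:R + x ^+ 2.

Lemma vcoef_sqdev m j x : let u t := baskakov m.+4 j t * (t - x) ^+ 2 in
  integrable0y u /\ m.+3%:R * \int[mu]_(t in D) u t = sqdev m x j.+1.
Proof.
move=> u.
pose c2 : R := (j.+1 * j.+2)%:R / (m.+3 * m.+2)%:R.
pose c1 : R := - (2 * x) * (j.+1%:R / m.+3%:R).
pose w t := c2 * baskakov m.+2 j.+2 t + c1 * baskakov m.+3 j.+1 t + x ^+ 2 * baskakov m.+4 j t.
have m3 : m.+3%:R != 0 :> R by rewrite pnatr_eq0.
have m2 : m.+2%:R != 0 :> R by rewrite pnatr_eq0.
have m1 : m.+1%:R != 0 :> R by rewrite pnatr_eq0.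
have uw t : w t = u t.
  have E1 : baskakov m.+3 j.+1 t = m.+3%:R * t * baskakov m.+4 j t / j.+1%:R.
    by rewrite -baskakovS // mulrC mulKf // pnatr_eq0.
  have E2 : baskakov m.+2 j.+2 t = m.+2%:R * t * baskakov m.+3 j.+1 t / j.+2%:R.
    by rewrite -baskakovS // mulrC mulKf // pnatr_eq0.
  rewrite /w /u E2 E1 /c2 /c1 !natrM; move: m3 m2.
  have : j.+1%:R != 0 :> R by rewrite pnatr_eq0.
  have : j.+2%:R != 0 :> R by rewrite pnatr_eq0.
  set a1 := m.+3%:R; set a2 := m.+2%:R; set b1 := j.+1%:R; set b2 := j.+2%:R.
  by clearbody a1 a2 b1 b2; move=> ? ? ? ?; field; apply/and4P.
have <- : w = u by apply/funext.
have iP k c i : integrable0y (fun t => c * baskakov k.+2 i t).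
  by apply: integrable_halflineZ; exact: integrable_baskakov.
have i12 : integrable0y (fun t => c2 * baskakov m.+2 j.+2 t + c1 * baskakov m.+3 j.+1 t).
  exact: (integrableD _ (iP m c2 j.+2) (iP m.+1 c1 j.+1)).
have iw : integrable0y w.
  exact: (integrableD _ i12 (iP m.+2 (x ^+ 2) j)).
split=> //.
rewrite /w RintegralD // ?RintegralD //; try exact: iP.
rewrite !RintegralZl ?Rintegral_baskakov //; try exact: integrable_baskakov.
rewrite /c2 /c1 /sqdev !natrM.
move: m3 m2 m1; set a1 := m.+3%:R; set a2 := m.+2%:R; set a3 := m.+1%:R.
by clearbody a1 a2 a3; move=> ? ? ?; field; apply/and3P.
Qed.

Lemma tame_cst y : tame (cst y) `|y| y.
Proof. by split=> [x _|x _|] //; exact: cvg_cst. Qed.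

Lemma vcoef_cst n k y : vcoef n k (cst y) = y.
Proof.
case: k => [|k]; first exact: vcoef0 (tame_cst y).
rewrite /vcoef (_ : (fun _ => _) = (fun t => y * baskakov n.+2 k t)); last first.
  by apply/funext => t; rewrite mulrC.
rewrite RintegralZl // ?Rintegral_baskakov; last exact: integrable_baskakov.
by rewrite mulrCA mulfV ?mulr1 // pnatr_eq0.
Qed.

(** A local modulus of continuity together with a quadratic bound away from [x] passes
to the coefficients, since [vcoef] is a positive functional preserving constants. *)
Lemma vcoef_near m k x y a C g B l : 0 <= C -> tame g B l ->
  (forall t, 0 < t -> `|g t - y| <= a + C * (t - x) ^+ 2) ->
  `|vcoef m.+2 k g - y| <= a + C * sqdev m x k.
Proof.
move=> C0 gT gy; have [gc gB gl] := gT.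
case: k => [|j].
  rewrite (vcoef0 _ gT) /sqdev mul0n mulr0 !mul0r subr0 add0r.
  have L : a + C * (t - x) ^+ 2 @[t --> 0^'+] --> a + C * (0 - x) ^+ 2.
    apply: cvg_within_filter; apply: cvgD; first exact: cvg_cst.
    apply: cvgM; first exact: cvg_cst.
    by apply: (@continuous_comp _ _ _ (fun t : R => t - x) (fun y => y ^+ 2));
      [apply: cvgB => //; exact: cvg_cst|exact: exprn_continuous].
  move: L; rewrite sub0r sqrrN => L.
  apply: (ler_cvg_to (cvg_norm (cvgB gl (cvg_cst y))) L).
  by near=> t; apply: gy; near: t; exact: nbhs_right_gt.
have hT := tameB gT (tame_cst y).
rewrite -[X in _ - X](vcoef_cst m.+2 j.+1 y) -(vcoefB _ _ gT (tame_cst y)).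
have [hc hB _] := hT.
have iPh : integrable0y (fun t => baskakov m.+4 j t * (g \- cst y) t).
  exact: integrable_baskakovM hB.
have [iu uE] := vcoef_sqdev m j x.
rewrite /vcoef normrM ger0_norm // -uE.
apply: (@le_trans _ _ (m.+3%:R * \int[mu]_(t in D)
    (a * baskakov m.+4 j t + C * (baskakov m.+4 j t * (t - x) ^+ 2)))).
  apply: ler_wpM2l => //.
  apply: le_trans (le_normr_Rintegral _ iPh) _ => //.
  apply: le_Rintegral => //.
  - have := integrable_norm iPh; exact.
  - apply: (integrableD _ (integrable_halflineZ a (integrable_baskakov j _)) (integrable_halflineZ C iu)) => //.
  - move=> t /=; rewrite in_itv /= andbT => t0.
    have P0 := baskakov_ge0 m.+4 j (ltW t0).
    rewrite normrM (ger0_norm P0).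
    have -> : a * baskakov m.+4 j t + C * (baskakov m.+4 j t * (t - x) ^+ 2) =
      baskakov m.+4 j t * (a + C * (t - x) ^+ 2) by ring.
    by apply: ler_wpM2l => //; exact: gy.
rewrite RintegralD //; [|exact: integrable_halflineZ (integrable_baskakov _ _)|exact: integrable_halflineZ iu].
rewrite !RintegralZl //; last exact: integrable_baskakov.
rewrite Rintegral_baskakov mulrDr mulrCA mulfV ?mulr1 ?pnatr_eq0 // lerD2l.
by rewrite mulrCA.
Unshelve. all: by end_near. Qed.

Lemma bsum_sqdev m x : 0 <= x -> bsum m.+2 x (sqdev m x) (2 * psi x / m.+1%:R).
Proof.
move=> x0.
have m2 : m.+2%:R != 0 :> R by rewrite pnatr_eq0.
have m1 : m.+1%:R != 0 :> R by rewrite pnatr_eq0.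
have := @bsum_moments R m.+2 x (x ^+ 2) ((m.+2 * m.+1)%:R^-1 - 2 * x / m.+2%:R)
   ((m.+2 * m.+1)%:R^-1) 0 0 isT x0.
rewrite /=; set s := (X in bsum _ _ _ X) => H.
have <- : s = 2 * psi x / m.+1%:R.
  rewrite /s natrM /psi -[m.+2%:R]natr1; move: m2 m1; rewrite -[m.+2%:R]natr1.
  by set a := m.+1%:R; clearbody a; move=> ? ?; field; apply/andP.
apply: eq_bsum H => k; rewrite /sqdev !natrM -[k.+1%:R]natr1.
by move: m2 m1; set a := m.+2%:R; set b := m.+1%:R; clearbody a b; move=> ? ?; field; apply/andP.
Qed.

(** Chebyshev's inequality: the mass far from [x] is controlled by the second
moment, which tends to 0. *)
Lemma cvg_operator g B l x (S : nat -> R) : tame g B l -> 0 < x ->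
  (forall m, bsum m.+2 x (fun k => vcoef m.+2 k g) (S m.+2)) ->
  S m @[m --> \oo] --> g x.
Proof.
move=> gT x0 HS; have [gc gB gl] := gT; have B0 := tame_ge0 gT.
rewrite -(cvg_shiftn 2); apply/cvgrPdist_le => e e0.
have e20 : 0 < e / 2 by rewrite divr_gt0.
have /cvgrPdist_le/(_ _ e20) := gc x x0.
rewrite near_simpl => /nbhs_ballP[d /= d0 Hd].
(* Beyond the distance [d] the bound [2 * B] on the increment is at most
   [C * (t - x)^2]. *)
pose C := 2 * B / d ^+ 2.
have C0 : 0 <= C by apply: divr_ge0; [exact: mulr_ge0|exact: sqr_ge0].
have gy t : 0 < t -> `|g t - g x| <= e / 2 + C * (t - x) ^+ 2.
  move=> t0; have [td|dt] := ltP `|x - t| d.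
    rewrite distrC; apply: le_trans (Hd t td) _.
    by rewrite lerDl; apply: mulr_ge0 => //; exact: sqr_ge0.
  apply: le_trans (ler_normB _ _) _.
  apply: (@le_trans _ _ (2 * B)).
    by have := gB t t0; have := gB x x0; lra.
  apply: (@le_trans _ _ (C * (t - x) ^+ 2)); last by rewrite lerDr ltW.
  rewrite /C mulrAC ler_pdivlMr ?exprn_gt0 //; apply: ler_wpM2l; first exact: mulr_ge0.
  by rewrite -[leRHS]real_normK ?num_real // distrC ler_pXn2r // nnegrE ltW.
near=> m; rewrite addn2 distrC.
have H1 : bsum m.+2 x (fun k => vcoef m.+2 k g - g x) (S m.+2 - g x).
  have := bsumD (HS m) (bsumZ (a := - g x) (bsum1 (isT : (0 < m.+2)%N) (ltW x0))).
  by rewrite mulr1.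
have H2 : bsum m.+2 x (fun k => e / 2 + C * sqdev m x k) (e / 2 + C * (2 * psi x / m.+1%:R)).
  have := bsumD (bsumZ (a := e / 2) (bsum1 (isT : (0 < m.+2)%N) (ltW x0)))
    (bsumZ (a := C) (@bsum_sqdev m x (ltW x0))).
  by rewrite mulr1.
have := bsum_norm_le (ltW x0) (fun k => @vcoef_near m k x _ _ C g _ _ C0 gT gy) H1 H2.
move=> /le_trans; apply; rewrite [leRHS]splitr lerD2l.
have m1 : (0 : R) < m.+1%:R by rewrite ltr0n.
rewrite mulrA ler_pdivrMr // -ler_pdivrMl //.
have : (e / 2)^-1 * (C * (2 * psi x)) <= m%:R.
  by near: m; exact: nbhs_infty_ger.
by move=> /le_trans; apply; rewrite ler_nat.
Unshelve. all: by end_near. Qed.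

End approximation.

(** * The approximation estimate *)

Section main.
Context {R : realType}.
Implicit Types (x y t B l a : R) (n k j m : nat) (f g h : R -> R).

Lemma is_derive_nondecreasing (F f : R -> R) a b : 0 < a -> a <= b ->
  (forall x, 0 < x -> is_derive x 1 F (f x)) -> (forall x, 0 < x -> 0 <= f x) ->
  F a <= F b.
Proof.
move=> a0 ab dF f0.
have pos x : x \in `]a, b[ -> 0 < x.
  by rewrite in_itv /= => /andP[+ _]; exact: lt_trans.
apply: (@ger0_derive1_ndecr R F a b) => //.
- by move=> x /pos x0; apply: ex_derive; exact: dF.
- by move=> x /pos x0; rewrite derive1E; have ? := dF x x0; rewrite derive_val f0.
- by apply: continuous_halfline_itv => // x x0; exact: is_derive_continuous (dF x x0).
Qed.

(** Adding to [g] the function [A1 * x + 4 * A2 * sqrt x], whose derivative dominates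
[|g'|], makes it nondecreasing, and a bounded monotone function has a limit. *)
Lemma exists_limit_at0 g (g' : R -> R) B (A1 A2 : R) : 0 <= A2 ->
  (forall x, 0 < x -> is_derive x 1 g (g' x)) ->
  (forall x, 0 < x -> `|g x| <= B) ->
  (forall x, 0 < x -> `|g' x| <= A1 + A2 * `|dphi x|) ->
  exists l, g x @[x --> 0^'+] --> l.
Proof.
move=> A20 dg gB g'b.
pose K x := A1 * x + 4 * A2 * Num.sqrt x.
have dK x : 0 < x -> is_derive x 1 K (A1 + 2 * A2 / Num.sqrt x).
  move=> x0; have s0 : Num.sqrt x != 0 by rewrite gt_eqF // sqrtr_gt0.
  have := is_deriveD (is_deriveZ A1 (is_derive_id x 1)) (is_deriveZ (4 * A2) (is_derive1_sqrt x0)).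
  by move=> d; apply: (is_derive_eq d); rewrite /GRing.scale /=; field.
have A10 : 0 <= A1 + A2 * `|dphi 1| by apply: le_trans (g'b 1 ltr01).
have mono a b : 0 < a -> a <= b -> g a + K a <= g b + K b.
  move=> a0 ab; apply: (@is_derive_nondecreasing (fun x => g x + K x)
    (fun x => g' x + (A1 + 2 * A2 / Num.sqrt x)) _ _ a0 ab) => x x0.
    exact: (is_deriveD (dg x x0) (dK x x0)).
  have := g'b x x0; rewrite ler_norml => /andP[+ _].
  have : A2 * `|dphi x| <= A2 * (2 / Num.sqrt x) by apply: ler_wpM2l => //; exact: dphi_bound.
  lra.
have K0 : K x @[x --> 0^'+] --> (0 : R).
  have Kc : K x @[x --> (0 : R)] --> K 0.
    apply: cvgD; apply: cvgM; try exact: cvg_cst; first exact: cvg_id.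
    exact: sqrt_continuous.
  by move: Kc; rewrite /K sqrtr0 !mulr0 addr0 => Kc; apply: cvg_within_filter.
have lb : has_lbound [set g x + K x | x in [set` Interval (BRight (0 : R)) (BLeft 1)]].
  exists (- B - `|A1|) => z [x /=]; rewrite in_itv /= => /andP[x0 x1] <-.
  have := gB x x0; rewrite ler_norml => /andP[+ _].
  have : 0 <= 4 * A2 * Num.sqrt x by rewrite !mulr_ge0 // sqrtr_ge0.
  have : - `|A1| <= A1 * x.
    apply: (@le_trans _ _ (- `|A1 * x|)); last by rewrite lerNl -[leRHS]normrN ler_norm.
    by rewrite lerN2 normrM (gtr0_norm x0) ler_piMr // ltW.
  rewrite /K; lra.
have := @nondecreasing_at_right_cvgr R (fun x => g x + K x) 0 (BLeft 1) _ _ lb.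
set L := inf _ => H.
exists (L - 0).
have -> : g = (fun x => (g x + K x) - K x) by apply/funext => x; rewrite addrK.
apply: cvgB => //; apply: H.
  by rewrite bnd_simp.
by move=> x y; rewrite !in_itv /= => /andP[x0 _] _ xy; exact: mono.
Qed.

Lemma Linfty_supnorm h : Linfty h -> exists2 b : R, 0 <= b & (supnorm h <= b%:E)%E.
Proof.
move=> [_ hfin]; have h0 := supnorm_ge0 h.
exists (fine (supnorm h)); first exact: fine_ge0.
by rewrite fineK // ge0_fin_numE.
Qed.

(** The hypotheses under which the coefficients of [g] and of [Dtilde g] exist
and can be integrated by parts. *)
Lemma W20_tame g B : W20 g -> W2 (Dtilde g) -> (forall x, 0 < x -> `|g x| <= B) ->
  exists (l B1 A1 A2 : R), [/\ tame g B l, tame (Dtilde g) B1 0 &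
    forall x, 0 < x -> `|derive1 g x| <= A1 + A2 * `|dphi x|].
Proof.
move=> [[gac gd g'ac Gfin] G0] [Gac Gd G'ac _] gB.
have [B1 B10 GB1] := Linfty_supnorm Gfin.
have Gc x : 0 < x -> {for x, continuous (Dtilde g)} by exact: AC_loc_continuous.
have inc a b : 0 < a -> a <= b -> `|derive1 g b - derive1 g a| <= B1 * (dphi b - dphi a).
  exact: derive1_increment_dphi.
have g'b x : 0 < x -> `|derive1 g x| <= (`|derive1 g 1| + B1 * `|dphi 1|) + B1 * `|dphi x|.
  move=> x0; rewrite -[leRHS]addrA -mulrDr.
  have -> : derive1 g x = derive1 g 1 + (derive1 g x - derive1 g 1) by ring.
  apply: le_trans (ler_normD _ _) _; rewrite lerD2l.
  have dn (p q : R) : p - q <= `|q| + `|p|.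
    by rewrite addrC; apply: lerD; [rewrite -normrN; exact: ler_norm|exact: ler_norm].
  have [x1|/ltW x1] := leP x 1.
    rewrite distrC; apply: le_trans (inc x 1 x0 x1) _; apply: ler_wpM2l => //.
    by rewrite [leRHS]addrC.
  by apply: le_trans (inc 1 x ltr01 x1) _; apply: ler_wpM2l.
have dg x : 0 < x -> is_derive x 1 g (derive1 g x).
  by move=> x0; rewrite derive1E; apply: derivableP; exact: gd.
have [l gl] := exists_limit_at0 B10 dg gB g'b.
exists l, B1, (`|derive1 g 1| + B1 * `|dphi 1|), B1; split=> //.
  by split=> // x x0; exact: is_derive_continuous (dg x x0).
split=> //; exact: supnorm_bound.
Qed.

(** [S k], [T k] and [U k] are the values at [x] of the [k]-th operator applied to [g],
to [Dtilde g] and, through second differences of coefficients, to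
[Dtilde (Dtilde g)]. *)
Lemma norm_Vtilde_sub g B M n x : W20 g -> W2 (Dtilde g) ->
  (forall t, 0 < t -> `|g t| <= B) -> (supnorm (Dtilde (Dtilde g)) <= M%:E)%E ->
  (0 < n)%N -> 0 < x -> `|Vtilde n g x - g x| <= M / n%:R ^+ 2.
Proof.
move=> gW GW gB GM n0 x0; pose G := Dtilde g.
have [l [B1 [A1 [A2 [gT GT g'b]]]]] := W20_tame gW GW gB.
have [[gac gd g'ac Gfin] G0] := gW; have [Gac Gd G'ac _] := GW.
have M0 : 0 <= M by rewrite -lee_fin; exact: le_trans (supnorm_ge0 _) GM.
have [Gc GB1 Gl] := GT.
have dg t : 0 < t -> is_derive t 1 g (derive1 g t).
  by move=> t0; rewrite derive1E; apply: derivableP; exact: gd.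
have dg' t : 0 < t -> is_derive t 1 (derive1 g) (G t / psi t).
  exact: is_derive_derive1.
have dG t : 0 < t -> is_derive t 1 G (derive1 G t).
  by move=> t0; rewrite derive1E; apply: derivableP; exact: Gd.
have G'c t : 0 < t -> {for t, continuous (derive1 G)} by exact: AC_loc_continuous.
have incG t s : 0 < t -> t <= s -> `|derive1 G s - derive1 G t| <= M * (dphi s - dphi t).
  exact: derive1_increment_dphi.
have wg k i : (0 < k)%N -> wdiff k (vcoef k ^~ g) i = vcoef k i G.
  move=> k0; case: i => [|i]; first by rewrite /wdiff mul0n mul0r (vcoef0 _ GT).
  exact: (vcoef_second_difference i k0 gT dg dg' Gc GB1 g'b).
have wG k i : (0 < k)%N -> `|wdiff k (vcoef k ^~ G) i| <= M.
  move=> k0; case: i => [|i]; first by rewrite /wdiff mul0n mul0r normr0.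
  exact: (norm_vcoef_second_difference i k0 M0 GT dG G'c incG).
have vg k i : `|vcoef k i g| <= B by exact: vcoef_le gT.
have vG k i : `|vcoef k i G| <= B1 by exact: vcoef_le GT.
have [S HS] := bsum_family (ltW x0) (fun k i _ => vg k i).
have [T HT] := bsum_family (ltW x0) (fun k i _ => vG k i).
have [U HU] := bsum_family (ltW x0) wG.
have HT' k : (0 < k)%N -> bsum k x (wdiff k (vcoef k ^~ g)) (T k).
  by move=> k0; apply: eq_bsum (HT k k0).1 => i; rewrite wg.
have VE : Vtilde n g x = S n - T n / n%:R.
  apply: cvg_lim => //.
  have := cvgB (HS n n0).1 (cvgM (cvg_cst (n%:R^-1 : R)) (cvg_series_Dtilde n0 x0 (vg n) (HT' n n0))).
  rewrite [_^-1 * T n]mulrC => H.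
  rewrite (_ : series _ = (fun N => series (fun k => vcoef n k g * baskakov n k x) N -
    n%:R^-1 * series (fun k => vcoef n k g * Dtilde (baskakov n k) x) N)); first exact: H.
  apply/funext => N; rewrite /series /= big_distrr /= -sumrB; apply: eq_bigr => k _.
  by rewrite /Ptilde; ring.
rewrite VE; apply: (@telescoping_bound R S T U) => //.
- by move=> k nk; have [] := HU k (leq_trans n0 nk).
- move=> k nk; have k0 := leq_trans n0 nk.
  exact: (bsum_up k0 (ltW x0) (vG k.+1) (fun i => vcoef_up k i GT) (HT k k0).1
     (HT k.+1 isT).1 (HU k k0).1).
- move=> k nk; have k0 := leq_trans n0 nk.
  exact: (bsum_up k0 (ltW x0) (vg k.+1) (fun i => vcoef_up k i gT) (HS k k0).1
     (HS k.+1 isT).1 (HT' k k0)).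
- by apply: (cvg_operator gT x0) => m; exact: (HS m.+2 isT).1.
Qed.

Lemma norm_Vtilde_le n x f g Bf Bg lf lg a : (2 <= n)%N -> 0 < x ->
  tame f Bf lf -> tame g Bg lg -> (forall t, 0 < t -> `|f t - g t| <= a) ->
  `|Vtilde n f x - Vtilde n g x| <= 2 * a.
Proof.
move=> n2 x0 fT gT fga.
have hT : tame (f \- g) a (lf - lg).
  by have [hc _ hl] := tameB fT gT; split.
have Pb N := series_norm_Ptilde_le2 N n2 x0.
have [cf _] := is_cvg_series_bounded (fun k => vcoef_le n k fT) Pb.
have [cg _] := is_cvg_series_bounded (fun k => vcoef_le n k gT) Pb.
have [_ lh] := is_cvg_series_bounded (fun k => vcoef_le n k hT) Pb.
rewrite mulrC; suff -> : Vtilde n f x - Vtilde n g x =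
  limn (series (fun k => vcoef n k (f \- g) * Ptilde n k x)) by [].
apply/esym/cvg_lim => //.
rewrite (_ : series _ = (fun N => series (fun k => vcoef n k f * Ptilde n k x) N -
   series (fun k => vcoef n k g * Ptilde n k x) N)); first exact: cvgB cf cg.
apply/funext => N; rewrite /series /= -sumrB; apply: eq_bigr => k _.
by rewrite (vcoefB n k fT gT) mulrBl.
Qed.

End main.

(** * The theorem *)

Theorem theorem1p1 (R : realType) (n : nat) (hn : (2 <= n)%N) (f : R -> R)
    (fcont : {within `[0, +oo[, continuous f})
    (fbounded : [bounded f x | x in `[0, +oo[]) :
  (supnorm (Vtilde n f \- f)%R <= 3%:E * Kfunctional f (n%:R ^+ 2)^-1%R)%E.
Proof.
have n0 : (0 < n)%N by exact: ltnW.
have [Bf [_ HBf]] := fbounded.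
have fB x : 0 < x -> `|f x| <= Bf + 1.
  by move=> x0; apply: HBf; rewrite ?ltrDl //= in_itv /= andbT ltW.
have [fc' f0] := (continuous_within_itvcyP _ _).1 fcont.
have fc x : 0 < x -> {for x, continuous f}.
  by move=> x0; apply: fc'; rewrite in_itv /= andbT.
have fT : tame f (Bf + 1) (f 0) by split.
rewrite -lee_pdivrMl //; apply: le_ereal_inf_tmp => _ [g [gW GW] <-].
rewrite lee_pdivrMl //.
(* When [f - g] is not essentially bounded the right-hand side is infinite. *)
have [->|] := eqVneq (supnorm (f \- g)) +oo%E.
  rewrite addye; first by rewrite gt0_muley ?lte_fin // leey.
  by rewrite gt_eqF // (lt_le_trans ltNy0) // mule_ge0 // ?lee_fin ?invr_ge0 ?sqr_ge0 ?supnorm_ge0.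
rewrite -ltey => fgfin.
have [[gac gd g'ac Gfin] G0] := gW; have [Gac Gd G'ac G2fin] := GW.
pose a := fine (supnorm (f \- g)). pose M := fine (supnorm (Dtilde (Dtilde g))).
have aE : supnorm (f \- g) = a%:E by rewrite fineK // ge0_fin_numE // supnorm_ge0.
have ME : supnorm (Dtilde (Dtilde g)) = M%:E by rewrite fineK // ge0_fin_numE ?supnorm_ge0 // G2fin.2.
have gc x : 0 < x -> {for x, continuous g} by exact: AC_loc_continuous.
have fga x : 0 < x -> `|f x - g x| <= a.
  move=> x0; apply: (@supnorm_bound R (f \- g)) => //; last by rewrite aE.
  by move=> t t0; apply: cvgB; [exact: fc|exact: gc].
have gB x : 0 < x -> `|g x| <= Bf + 1 + a.
  move=> x0; have -> : g x = f x - (f x - g x) by ring.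
  by apply: le_trans (ler_normB _ _) _; rewrite lerD ?fB ?fga.
have [l [_ [_ [_ [gT _ _]]]]] := W20_tame gW GW gB.
rewrite aE ME (_ : (3%:E * _)%E = (3 * (a + (n%:R ^+ 2)^-1 * M))%:E) //.
apply/supnorm_leP.
(* The estimates hold for positive [x]; the point 0 is negligible. *)
have nz : {ae @lebesgue_measure R, forall x : R, x != 0}.
  exists [set 0]; split => //; first exact: lebesgue_measure_set1.
  by move=> x /= /negP; rewrite negbK => /eqP.
move: nz; apply: filterS; first exact: (ae_filter_ringOfSetsType (@lebesgue_measure R)).
move=> x xn0 x0; have {xn0}x0 : 0 < x by rewrite lt_neqAle eq_sym xn0.
have E1 := norm_Vtilde_le hn x0 fT gT fga.
have E2 : `|Vtilde n g x - g x| <= M / n%:R ^+ 2.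
  have GM : (supnorm (Dtilde (Dtilde g)) <= M%:E)%E by rewrite ME.
  exact: (norm_Vtilde_sub gW GW gB GM n0 x0).
have E3 := fga x x0.
have -> : (Vtilde n f \- f) x = (Vtilde n f x - Vtilde n g x) + (Vtilde n g x - g x) - (f x - g x).
  by rewrite /=; ring.
apply: le_trans (ler_normB _ _) _.
apply: le_trans (lerD (ler_normD _ _) (lexx _)) _.
have M0 : 0 <= M / n%:R ^+ 2 by exact: le_trans E2.
lra.
Qed.
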